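(* Let $G$ be a finite group and let $R$ be an integral domain with field of fractions $K$ such that $|G|$ is invertible in $K$. Assume that for every subgroup $U\le G$ and every prime divisor $p$ of $|\mathrm{Out}(U)|$ one has $\{0\}\neq pR\neq R$. Let $\pi$ be the set of prime divisors of $|G|$ which are not invertible in $R$. For each $\pi$-perfect subgroup $V\le G$ put \[\varepsilon_V^{(\pi)}:=\sum_{\substack{V'\in\widetilde{\Sigma}_G\\ V'^{(\pi)}=_G V}} e_{V'}\in KB(G),\] and for $W\in\widehat{\Theta}^{\pi}_G$ put \[\widehat{\varepsilon}_W^{(\pi)}:=\sum_{\substack{V\in\widetilde{\Theta}^{\pi}_G\\ V\cong W}}\varepsilon_V^{(\pi)}.\] Then the elements $\Delta(\widehat{\varepsilon}_W^{(\pi)})$, $W\in\widehat{\Theta}^{\pi}_G$, are primitive, pairwise orthogonal idempotents of the center $Z(RB^\Delta(G,G))$ whose sum is $1$. In particular, the primitive central idempotents of $RB^\Delta(G,G)$ are parametrized by the isomorphism classes of $\pi$-perfect subgroups of $G$.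
   Context: Burnside ring: $B(G)$ is the Grothendieck ring of finite left $G$-sets (sum = disjoint union, product = direct product); for $H\le G$ the mark homomorphism $\Phi_H\colon B(G)\to\mathbb{Z}$ is $\Phi_H([X])=|X^H|$, extended $K$-linearly to $KB(G)=K\otimes_{\mathbb{Z}}B(G)$. For $U\le G$, $e_U\in KB(G)$ is the unique element with $\Phi_{U'}(e_U)=1$ if $U'$ is $G$-conjugate to $U$ and $\Phi_{U'}(e_U)=0$ otherwise. $\widetilde{\Sigma}_G$ is a set of representatives of the conjugacy classes of subgroups of $G$; $=_G$ means $G$-conjugate. A group $U$ is $\pi$-perfect if it has no quotient of prime order $p\in\pi$; $U^{(\pi)}$ is the smallest normal subgroup of $U$ whose quotient is solvable of order divisible only by primes in $\pi$. $\widetilde{\Theta}^\pi_G$ is the set of $\pi$-perfect elements of $\widetilde{\Sigma}_G$, and $\widehat{\Theta}^\pi_G\subseteq\widetilde{\Theta}^\pi_G$ is a set of representatives of the isomorphism classes of $\pi$-perfect subgroups of $G$. Double Burnside ring: a finite $(G,G)$-biset is a finite set with commuting left and right $G$-actions, identified with a left $G\times G$-set via $(g,h)x=gxh^{-1}$. $B(G,G)$ is the Grothendieck group of finite $(G,G)$-bisets with respect to disjoint union, with multiplication induced by $X\times_G Y$ (the set of $G$-orbits of $X\times Y$ under $g(x,y)=(xg^{-1},gy)$). For $L\le G\times G$ put $k_1(L)=\{g\mid (g,1)\in L\}$, $k_2(L)=\{g\mid(1,g)\in L\}$. The bifree double Burnside ring $B^\Delta(G,G)$ is the subring spanned by classes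 of bisets all of whose point stabilizers $L$ satisfy $k_1(L)=k_2(L)=1$; $RB^\Delta(G,G)=R\otimes_{\mathbb{Z}}B^\Delta(G,G)$, viewed inside $KB^\Delta(G,G)$. The map $\Delta\colon B(G)\to B^\Delta(G,G)$, $[G/U]\mapsto[G\times G/\Delta(U)]$ with $\Delta(U)=\{(u,u)\mid u\in U\}$, is a ring homomorphism, extended $K$-linearly. *)

(* Defs.v *)
From HB Require Import structures.
From mathcomp Require Import all_boot all_order all_algebra all_fingroup all_solvable.
From mathcomp Require Import fraction.
Set Implicit Arguments. Unset Strict Implicit. Unset Printing Implicit Defensive.
Import GRing.Theory.
Local Open Scope group_scope.

Section Burnside.
Variables (gT : finGroupType) (G : {group gT}).

Definition conjG (A B : {set gT}) : bool := [exists g in G, A == B :^ g].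

Definition Out (U : {group gT}) := (Aut U / (conj_aut U @* U))%g.

Definition pi_perfect (pi : nat_pred) (U : {set gT}) : bool :=
  [forall N : {group gT}, (N <| U) ==> ~~ (prime #|U / N| && (#|U / N| \in pi))].

Definition piRes (pi : nat_pred) (U : {set gT}) : {set gT} :=
  \bigcap_(N : {group gT} | [&& N <| U, solvable (U / N) & pi.-group (U / N)]) N.

(* A formal combination x : {ffun {group gT} -> K} stands for
   \sum_(U <= G) x U [G/U]; elements of K B(G) are compared through marks. *)

Definition gmark (U H : {set gT}) : nat :=
  #|[set C in lcosets U G | [forall h in H, h *: C == C]]|.

Definition gmk (K : nzRingType) (x : {ffun {group gT} -> K}) (H : {set gT}) : K :=
  (\sum_(U : {group gT} | U \subset G) x U * (gmark U H)%:R)%R.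

(* (G,G)-bisets = left G x G-sets via (g,h)x = g x h^-1.
   A formal combination x : {ffun {group (gT*gT)} -> K} stands for
   \sum_(L <= G x G) x L [G x G / L]. *)

Definition GG : {set gT * gT} := setX G G.

Definition bmark (L N : {set gT * gT}) : nat :=
  #|[set C in lcosets L GG | [forall n in N, n *: C == C]]|.

Definition bmk (K : nzRingType) (x : {ffun {group (gT * gT)} -> K}) (N : {set gT * gT}) : K :=
  (\sum_(L : {group (gT * gT)} | L \subset GG) x L * (bmark L N)%:R)%R.

(* X x_G Y for X = G x G/L, Y = G x G/M: the G-orbits of X x Y under
   g(x,y) = (x g^-1, g y) = ((1,g)x, (g,1)y), with the G x G-action
   (a,c)[x,y] = [a x c'... ] = [(a,1)x, (1,c)y]. *)
Definition pt := ({set gT * gT} * {set gT * gT})%type.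

Definition orbG (p : pt) : {set pt} :=
  [set (((1 : gT), g) *: p.1, (g, (1 : gT)) *: p.2) | g in G].

Definition orbs (L M : {set gT * gT}) : {set {set pt}} :=
  [set orbG p | p in setX (lcosets L GG) (lcosets M GG)].

Definition actLR (n : gT * gT) (O : {set pt}) : {set pt} :=
  [set ((n.1, (1 : gT)) *: p.1, ((1 : gT), n.2) *: p.2) | p in O].

Definition prodmark (L M N : {set gT * gT}) : nat :=
  #|[set O in orbs L M | [forall n in N, actLR n O == O]]|.

Definition pmk (K : nzRingType) (x y : {ffun {group (gT * gT)} -> K}) (N : {set gT * gT}) : K :=
  (\sum_(L : {group (gT * gT)} | L \subset GG)
     \sum_(M : {group (gT * gT)} | M \subset GG) x L * y M * (prodmark L M N)%:R)%R.

Section Ring.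
Variable K : nzRingType.
Implicit Types x y z : {ffun {group (gT * gT)} -> K}.

(* equality in K B(G,G) (detected by marks on subgroups of G x G) *)
Definition beq x y : Prop := forall N : {group (gT * gT)}, N \subset GG -> bmk x N = bmk y N.
Definition bprod_eq x y z : Prop :=
  forall N : {group (gT * gT)}, N \subset GG -> pmk x y N = bmk z N.
Definition bcomm x y : Prop :=
  forall N : {group (gT * gT)}, N \subset GG -> pmk x y N = pmk y x N.
Definition borth x y : Prop :=
  forall N : {group (gT * gT)}, N \subset GG -> pmk x y N = 0%R.
Definition bzero x : Prop := beq x 0%R.
Definition bidem x : Prop := bprod_eq x x x.

Definition diag (U : {set gT}) : {set gT * gT} := [set (u, u) | u in U].

Definition bone : {ffun {group (gT * gT)} -> K} :=
  [ffun L : {group (gT * gT)} => (((L : {set gT * gT}) == diag G)%:R)%R].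

(* K-linear extension of Delta : [G/U] |-> [G x G / Delta(U)] *)
Definition Dlt (x : {ffun {group gT} -> K}) : {ffun {group (gT * gT)} -> K} :=
  [ffun L : {group (gT * gT)} =>
     (\sum_(U : {group gT} | (U \subset G) && ((L : {set gT * gT}) == diag U)) x U)%R].
End Ring.

Definition k1 (L : {set gT * gT}) : {set gT} := [set g | (g, 1) \in L].
Definition k2 (L : {set gT * gT}) : {set gT} := [set g | (1, g) \in L].

(* point stabilizers of [G x G/L] are the conjugates of L, which all have
   trivial k1, k2 iff L has. *)
Definition bifree (L : {set gT * gT}) : bool :=
  [&& L \subset GG, k1 L == 1%g & k2 L == 1%g].

Section Frac.
Variable R : idomainType.
Local Notation K := {fraction R}.

Definition inRBD (x : {ffun {group (gT * gT)} -> K}) : Prop :=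
  exists r : {ffun {group (gT * gT)} -> R},
    (forall L, r L != 0%R -> bifree L) /\ beq x [ffun L => tofrac (r L)].

Definition inZ (x : {ffun {group (gT * gT)} -> K}) : Prop :=
  inRBD x /\ forall y, inRBD y -> bcomm x y.

Definition central_idem (e : {ffun {group (gT * gT)} -> K}) : Prop :=
  inZ e /\ bidem e.

Definition prim_central_idem (e : {ffun {group (gT * gT)} -> K}) : Prop :=
  [/\ central_idem e, ~ bzero e &
      forall f1 f2, central_idem f1 -> central_idem f2 -> borth f1 f2 ->
        beq e (f1 + f2)%R -> bzero f1 \/ bzero f2].

Definition piG : nat_pred :=
  [pred p | [&& prime p, p %| #|G| & ~~ (((p%:R)%R : R) \is a GRing.unit)]].
End Frac.

Definition conj_reps (Sig : {set {group gT}}) : Prop :=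
  [/\ forall U, U \in Sig -> U \subset G,
      forall H : {group gT}, H \subset G -> exists2 U, U \in Sig & conjG H U &
      forall U V, U \in Sig -> V \in Sig -> conjG U V -> U = V].

Definition Theta_t (pi : nat_pred) (Sig : {set {group gT}}) : {set {group gT}} :=
  [set V in Sig | pi_perfect pi V].

Definition iso_reps (pi : nat_pred) (Sig Th : {set {group gT}}) : Prop :=
  [/\ Th \subset Theta_t pi Sig,
      forall H : {group gT}, H \subset G -> pi_perfect pi H ->
        exists2 W, W \in Th & H \isog W &
      forall W W', W \in Th -> W' \in Th -> W \isog W' -> W = W'].

(* x represents hat-epsilon_W^(pi) = sum_{V in tTheta, V ~= W} eps_V, with
   eps_V = sum_{V' in Sig, V'^(pi) =_G V} e_V', e_V' given by its marks. *)
Definition is_eps_hat (K : nzRingType) (pi : nat_pred) (Sig : {set {group gT}})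
  (W : {group gT}) (x : {ffun {group gT} -> K}) : Prop :=
  forall H : {group gT}, H \subset G ->
    gmk x H =
    (\sum_(V in Theta_t pi Sig | V \isog W)
       \sum_(V' in Sig | conjG (piRes pi V') V) (conjG H V')%:R)%R.

End Burnside.

(* Main.v *)
(* A central element of K B^Delta(G,G) is determined by its marks at the twisted diagonal
   subgroups, i.e. at the isomorphisms N between subgroups of G, and the product becomes a
   convolution over this groupoid, divided by |G|.  Commuting with the Delta-images of class
   indicators makes a central idempotent f vanish off the isomorphisms between conjugate
   subgroups.  Its restriction to Aut(U) is then an idempotent up to the factor |N_G(U)|, and
   comparing trace and rank for f and for 1 - f gives r = n c, where r <= n is a rank,
   n = |Aut(U) : Aut_G(U)| divides |Out(U)|, and c in R is the mark of f at Delta(U) divided by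
   |C_G(U)|.  Since the primes dividing n are neither zero nor invertible in R, r is 0 or n,
   so f acts on the component of U as c(U) in {0,1}.  Centrality makes c isomorphism
   invariant, and a Burnside count on Delta(N)-fixed points gives c(N) = c(U) modulo p
   whenever N <| U has index p in pi; hence c(U) = c(U^(pi)), and f is a sum of the elements
   Delta(hat-eps_W).  Conversely hat-eps_W lies in R B(G): its marks are constant along
   normal extensions by p-groups for p in pi, which yields the p-local Burnside congruences,
   and the remaining primes dividing |G| are invertible in R. *)

Require Import Defs.
From HB Require Import structures.
From mathcomp Require Import all_boot all_order all_algebra all_fingroup all_solvable.
From mathcomp Require Import fraction ring.
Import GRing.Theory.
Local Open Scope ring_scope.

Set Implicit Arguments.
Unset Strict Implicit.
Unset Printing Implicit Defensive.

(** * Marks of transitive G-sets *)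

Section Marks.
Local Open Scope group_scope.
Variables (gT : finGroupType) (G : {group gT}).
Implicit Types (U H L P : {group gT}) (C : {set gT}).

(** Formal combinations are not reduced modulo conjugacy, so it has to be proved that the product
    depends on marks alone. The factor |G| of the convolution comes from the free action of G on
    pairs of cosets. The unit has mark [ucount N] at N, so acting as a scalar c means having marks
    c(snd N) [ucount N]; this covers isomorphisms that are not induced by G as well, where both
    sides are 0. Idempotency over K alone would allow a fractional c. Its integrality comes from a
    Burnside count for (C_G(U) x 1) Delta(U), which is larger than Delta(U) by exactly the factor
    |C_G(U)| to be divided out. Traces determine ranks only as elements of K, where natural numbers
    may collapse. If n > 1, a prime p dividing n excludes this: in characteristic q the prime p,
    being nonzero, would be coprime to q and hence invertible. If n = 1 there is no such prime, but
    then every automorphism of U is induced by G, f is constant on Aut(U), and c^2 = c follows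
    directly. *)

Lemma conjG_sub (H : {set gT}) g : g \in G -> (H :^ g \subset G) = (H \subset G).
Proof. by move=> Gg; rewrite -{1}(conjGid Gg) conjSg. Qed.

Lemma lcoset_fix h g U : (h *: (g *: U) == g *: U) = (h ^ g \in U).
Proof.
rewrite -lcosetM (sameP eqP lcoset_eqP) mem_lcoset conjgE mulgA.
by [].
Qed.

Lemma lcoset_fix_sub g U (H : {set gT}) :
  [forall h in H, h *: (g *: U) == g *: U] = (H :^ g \subset U).
Proof.
apply/forall_inP/subsetP => [hH _ /imsetP[h Hh ->]|sHU h Hh].
  by rewrite -lcoset_fix hH.
by rewrite lcoset_fix sHU // memJ_conjg.
Qed.

Lemma sum_lcosets (F : {set gT} -> nat) U : U \subset G ->
  (\sum_(g in G) F (g *: U) = #|U| * \sum_(C in lcosets U G) F C)%N.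
Proof.
move=> sUG; rewrite (partition_big (fun g => g *: U) (mem (lcosets U G))) /=; last first.
  by move=> g Gg; rewrite mem_lcosets mulGSid.
rewrite big_distrr /=; apply: eq_bigr => _ /lcosetsP[g Gg ->].
rewrite (eq_bigr (fun=> F (g *: U))) => [|h /andP[_ /eqP->]] //.
rewrite sum_nat_const; congr (_ * _)%N; rewrite -(card_lcoset U g); apply: eq_card => h.
rewrite [LHS]unfold_in /= (sameP eqP lcoset_eqP) andb_idl // => /lcosetP[u Uu ->].
by rewrite groupM // (subsetP sUG).
Qed.

(** Counting elements of G instead of cosets costs a factor |U| and turns fixed points into
    conjugates of H inside U, the form in which marks are compared below. *)
Lemma mark_count U (H : {set gT}) : U \subset G ->
  (#|U| * gmark G U H)%N = #|[set g in G | H :^ g \subset U]|.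
Proof.
move=> sUG.
have -> : gmark G U H = (\sum_(C in lcosets U G) [forall h in H, h *: C == C])%N.
  rewrite /gmark -sum1dep_card (eq_bigl (fun C =>
    (C \in lcosets U G) && [forall h in H, h *: C == C])).
    by rewrite big_mkcondr; apply: eq_bigr => C _; case: ifP.
  by move=> C; rewrite ?inE.
rewrite -sum_lcosets // -sum1dep_card big_mkcondr; apply: eq_bigr => g _.
by rewrite lcoset_fix_sub; case: ifP.
Qed.

Lemma gmark_neq0 U (H : {set gT}) : U \subset G -> gmark G U H != 0%N ->
  exists2 g, g \in G & H :^ g \subset U.
Proof.
move=> sUG nz; have: (#|U| * gmark G U H)%N != 0%N by rewrite muln_eq0 negb_or -lt0n cardG_gt0.
by rewrite mark_count // cards_eq0 => /set0Pn[g]; rewrite inE => /andP[? ?]; exists g.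
Qed.

Lemma gmark_diag U : U \subset G -> (#|U| * gmark G U U)%N = #|'N_G(U)|.
Proof. by move=> sUG; rewrite mark_count //; apply: eq_card => g; rewrite !inE. Qed.

Lemma card_shift (A B : {set gT}) k : k \in G ->
  (forall g, g \in G -> (g \in A) = (k * g \in B)) -> #|G :&: A| = #|G :&: B|.
Proof.
move=> Gk AB; rewrite -(card_imset (G :&: A) (mulgI k)); apply: eq_card => g; apply/imsetP/setIP.
  by case=> h /setIP[Gh Ah] ->; rewrite groupM // -AB.
by case=> Gg Bg; exists (k^-1 * g); rewrite ?mulKVg // !inE groupM ?groupV ?AB ?mulKVg ?groupM
  ?groupV.
Qed.

Lemma gmarkJr U (H : {set gT}) k : U \subset G -> k \in G -> gmark G U (H :^ k) = gmark G U H.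
Proof.
move=> sUG Gk; apply/eqP; rewrite -(eqn_pmul2l (cardG_gt0 U)) !mark_count //; apply/eqP.
have E (A : {set gT}) : [set g in G | A :^ g \subset U] = G :&: [set g | A :^ g \subset U].
  by apply/setP=> g; rewrite !inE.
by rewrite !E; apply: (@card_shift _ _ k) => // g _; rewrite !inE conjsgM.
Qed.

Lemma gmarkJl U (H : {set gT}) k : U \subset G -> k \in G -> gmark G (U :^ k) H = gmark G U H.
Proof.
move=> sUG Gk; have sUkG : (U :^ k)%G \subset G by rewrite /= conj_subG.
apply/eqP; rewrite -(eqn_pmul2l (cardG_gt0 U)) -{1}(cardJg U k) !mark_count //; apply/eqP.
rewrite -(card_imset [set g in G | H :^ g \subset U] (mulIg k)).
apply: eq_card => g; rewrite inE; apply/andP/imsetP=> [[Gg sH]|[h]].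
  exists (g * k^-1); last by rewrite mulgKV.
  by rewrite inE groupM ?groupV // conjsgM sub_conjgV.
by rewrite inE => /andP[Gh sH] ->; rewrite groupM // conjsgM conjSg.
Qed.

Lemma gmark_top (H : {set gT}) : H \subset G -> gmark G G H = 1%N.
Proof.
move=> sHG; apply/eqP; rewrite -(eqn_pmul2l (cardG_gt0 G)) muln1 mark_count //; apply/eqP.
by apply: eq_card => g; rewrite inE andb_idr // => Gg; rewrite -(conjGid Gg) conjSg.
Qed.

Definition lact (C : {set gT}) g := g^-1 *: C.

Lemma lact1 : lact^~ 1 =1 id.
Proof. by move=> C; rewrite /lact invg1 lcoset1. Qed.

Lemma lactM C : act_morph lact C.
Proof. by move=> a b; rewrite /lact invMg lcosetM. Qed.

Definition lact_action := TotalAction lact1 lactM.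

(** P acts on the U-fixed points of G/L because it normalizes U, and those also fixed by g are the
    fixed points of U<g>. The sum is therefore |P| times a number of orbits. *)
Lemma mark_burnside L U P : L \subset G -> U <| P -> P \subset G ->
  (#|P| %| \sum_(g in P) gmark G L (U <*> <[g]>))%N.
Proof.
move=> sLG /andP[sUP nUP] sPG.
pose F := [set C in lcosets L G | [forall h in U, h *: C == C]].
have actF : [acts P, on F | lact_action].
  apply/subsetP=> g Pg; rewrite inE in_setT inE; apply/subsetP=> C; rewrite !inE /= /lact.
  case/andP=> /lcosetsP[k Gk ->] /forall_inP fixC.
  have Gg : g \in G by rewrite (subsetP sPG).
  rewrite -lcosetM mem_lcosets mulGSid // groupM ?groupV //=.
  apply/forall_inP=> h Uh; have := fixC (h ^ g^-1).
  rewrite memJ_norm ?groupV ?(subsetP nUP) // => /(_ Uh).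
  by rewrite !lcoset_fix conjgM.
have := Frobenius_Cauchy actF; set S := (\sum_(a in P) _)%N => E.
suff -> : (\sum_(g in P) gmark G L (U <*> <[g]>))%N = S by rewrite E dvdn_mull.
apply: eq_bigr => g Pg; apply: eq_card => C; rewrite !inE sub1set inE /= /lact.
case CL: (C \in lcosets L G) => //=; case/lcosetsP: CL => k Gk ->.
rewrite !lcoset_fix_sub !sub_conjg join_subG cycle_subG mem_conjgV.
by rewrite lcoset_fix conjVg groupV.
Qed.

End Marks.

(** * Integrality from Burnside congruences *)

Section Divisibility.
Variable R : idomainType.

Definition ndvd (n : nat) (x : R) := exists c, x = c * n%:R.

(** R is an arbitrary domain, so two coprime integer divisors are combined through a Bezout relation
    between the integers. *)
Lemma ndvd_coprime m n (x : R) : coprime m n -> ndvd m x -> ndvd n x -> ndvd (m * n) x.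
Proof.
case: (posnP m) => [->|m_gt0]; first by move=> _ [c ->] _; exists c; rewrite mul0n.
move=> /eqP co [c Ec] [d Ed]; have [a b] := egcdnP n m_gt0; rewrite co => E _.
exists (a%:R * d - b%:R * c).
have: x * (a * m)%:R = x * (b * n + 1)%:R by rewrite E.
rewrite natrD mulrDr mulr1 => /esym/(canRL (addKr _)) E'.
rewrite E' {1}Ec {1}Ed !natrM; ring.
Qed.

Lemma ndvd_parts n (x : R) : (0 < n)%N ->
  (forall p, prime p -> (p %| n)%N -> ndvd (n`_p)%N x) -> ndvd n x.
Proof.
elim/ltn_ind: n => n IH n_gt0 H.
have [n1|n1] := leqP n 1.
  by exists x; have -> : n = 1%N; [apply/eqP; rewrite eqn_leq n1 | rewrite mulr1].
have pr_p := pdiv_prime n1; set p := pdiv n in pr_p; have dvp : (p %| n)%N by rewrite pdiv_dvd.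
rewrite -(partnC p n_gt0); apply: ndvd_coprime; first by rewrite coprime_partC.
  exact: H.
have lt: (n`_p^' < n)%N.
  rewrite -{2}(partnC p n_gt0) ltn_Pmull ?part_gt0 //.
  by rewrite p_part_gt1 mem_primes pr_p n_gt0.
apply: IH => // q pr_q dvq.
have qp : q \in (p^' : nat_pred).
  have : q \in \pi(n`_p^')%N by rewrite mem_primes pr_q part_gt0.
  by rewrite pi_of_part // inE => /andP[].
have qn : (q %| n)%N by apply: dvdn_trans dvq (dvdn_part _ _).
by rewrite partn_part; [exact: H | move=> r; rewrite inE => /eqP->].
Qed.
End Divisibility.

Section GmkLinear.
Variables (gT : finGroupType) (G : {group gT}) (K : nzRingType).
Implicit Types (x y : {ffun {group gT} -> K}) (H : {set gT}).

Lemma gmkD x y H : gmk G (x + y) H = gmk G x H + gmk G y H.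
Proof. by rewrite /gmk -big_split; apply: eq_bigr => U _; rewrite ffunE mulrDl. Qed.

Lemma gmkN x H : gmk G (- x) H = - gmk G x H.
Proof. by rewrite /gmk -sumrN; apply: eq_bigr => U _; rewrite ffunE mulNr. Qed.

Lemma gmk0 H : gmk G (0 : {ffun {group gT} -> K}) H = 0.
Proof. by rewrite /gmk big1 // => U _; rewrite ffunE mul0r. Qed.

Definition gdelta (U : {group gT}) (c : K) : {ffun {group gT} -> K} :=
  [ffun L : {group gT} => if L == U then c else 0].

Lemma gmk_delta (U : {group gT}) c H : U \subset G ->
  gmk G (gdelta U c) H = c * (gmark G U H)%:R.
Proof.
move=> sUG; rewrite /gmk (bigD1 U) //= ffunE eqxx big1 ?addr0 // => L /andP[_ /negbTE nL].
by rewrite ffunE nL mul0r.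
Qed.

Lemma gmkJ x H k : k \in G -> gmk G x (H :^ k)%g = gmk G x H.
Proof. by move=> Gk; apply: eq_bigr => U sUG; rewrite gmarkJr. Qed.

End GmkLinear.

(** * Class functions that are mark functions of elements over R *)

Section MarkSurj.
Local Open Scope group_scope.
Local Open Scope ring_scope.
Variables (gT : finGroupType) (G : {group gT}) (R : idomainType).
Hypothesis nzG : #|G|%:R != 0 :> R.
Implicit Types (U H L P : {group gT}).

(** Subtracting a multiple of [G/U] alters marks below U and may enlarge the support of d, but not
    this downward closure; its size is the induction measure. *)
Definition down (d : {group gT} -> R) : {set {group gT}} :=
  [set H : {group gT} | [exists H' : {group gT}, (H \subset H') && (d H' != 0)]].

Lemma subG_nz U : U \subset G -> #|U|%:R != 0 :> R.
Proof.
by move=> /cardSg/dvdnP[k E]; apply: contraNneq nzG; rewrite E natrM => ->; rewrite mulr0.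
Qed.

Lemma gmk_burnside (r : {ffun {group gT} -> R}) U P : U <| P -> P \subset G ->
  ndvd #|P| (\sum_(g in P) gmk G r (U <*> <[g]>)%g).
Proof.
move=> nUP sPG; rewrite /gmk exchange_big /=.
exists (\sum_(L : {group gT} | L \subset G) r L *
   ((\sum_(g in P) gmark G L (U <*> <[g]>)%g) %/ #|P|)%:R).
rewrite mulr_suml; apply: eq_bigr => L sLG.
rewrite -mulrA -natrM divnK ?mark_burnside // natr_sum mulr_sumr.
by [].
Qed.

Lemma sum_joing_max (d : {group gT} -> R) U P : U \subset P ->
  (forall H, U \proper H -> d H = 0) ->
  \sum_(g in P) d (U <*> <[g]>)%G = #|U|%:R * d U.
Proof.
move=> sUP max; rewrite (bigID (mem U)) /= [X in _ + X]big1 ?addr0; last first.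
  move=> g /andP[Pg nUg]; apply: max; rewrite properE joing_subl.
  by apply: contra nUg; rewrite join_subG cycle_subG => /andP[].
rewrite (eq_bigr (fun=> d U)) => [|g /andP[_ Ug]]; last first.
  by congr d; apply/val_inj/joing_idPl; rewrite cycle_subG.
rewrite (eq_bigl [in U]) => [|g /=]; last by rewrite andb_idl // => /(subsetP sUP).
by rewrite sumr_const mulr_natl.
Qed.

(** The table of marks is triangular: at a largest U in the support, d(U) has to be divisible by
    |N_G(U) : U|, the mark of G/U at U, and that multiple of [G/U] is subtracted. The clause on the
    support of r later keeps test elements inside the bifree ring. *)
Lemma marks_surj (d : {group gT} -> R) :
    (forall H g, g \in G -> d (H :^ g)%G = d H) ->
    (forall H, ~~ (H \subset G) -> d H = 0) ->
    (forall p, prime p -> (p %| #|G|)%N -> (p%:R : R) \is a GRing.unit \/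
       forall U P, U <| P -> P \subset G -> p.-group (P / U)%g ->
         ndvd #|P| (\sum_(g in P) d (U <*> <[g]>)%G)) ->
  exists r : {ffun {group gT} -> R},
    (forall L, r L != 0 -> exists2 H : {group gT}, L \subset H & d H != 0) /\
    (forall H, H \subset G -> gmk G r H = d H).
Proof.
move: {2}#|down d| (leqnn #|down d|) => n; elim: n d => [|n IH] d le dJ dG dp.
  exists 0; split=> [L|H sHG]; first by rewrite ffunE eqxx.
  rewrite gmk0; apply/esym/eqP; apply: contraLR le => nz; rewrite -ltnNge card_gt0.
  by apply/set0Pn; exists H; rewrite inE; apply/existsP; exists H; rewrite subxx.
have [/existsP[U0 nz0]|] := boolP [exists U, d U != 0]; last first.
  rewrite negb_exists => /forallP z; exists 0; split=> [L|H sHG]; first by rewrite ffunE eqxx.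
  by rewrite gmk0; apply/esym/eqP; rewrite -[_ == _]negbK.
case: (@arg_maxnP _ U0 (fun U => d U != 0) (fun U : {group gT} => #|U|) nz0) => U nzU maxU.
have max H : U \proper H -> d H = 0.
  move=> pr; apply/eqP; rewrite -[_ == _]negbK; apply/negP => /maxU.
  by rewrite /= leqNgt proper_card.
have sUG : U \subset G by apply: contraR nzU => /dG ->.
have nUN : U <| 'N_G(U) by rewrite normal_subnorm.
have Umark : gmark G U U = #|('N_G(U) / U)%g|.
  apply/eqP; rewrite card_quotient ?subsetIr // -(eqn_pmul2l (cardG_gt0 U)).
  by rewrite gmark_diag // Lagrange // normal_sub.
have [c Ec] : ndvd (gmark G U U) (d U).
  rewrite Umark; apply: ndvd_parts => [|p pr_p dvp]; first exact: cardG_gt0.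
  have pG : (p %| #|G|)%N.
    apply: dvdn_trans dvp _; apply: dvdn_trans (dvdn_quotient _ _) _.
    by rewrite cardSg // subsetIl.
  have [up|/(_ U)] := dp p pr_p pG.
    exists (d U / (#|('N_G(U) / U)%g|`_p)%:R); rewrite divrK // p_part natrX.
    by rewrite unitrX.
  (* P/U is a Sylow p-subgroup of N_G(U)/U. By maximality of U only the g in U contribute to the
     congruence, which becomes |U| d(U) = |P| e; cancelling |U| leaves divisibility by |P : U|. *)
  have [S sylS] := Sylow_exists p ('N_G(U) / U)%G.
  have [P defS sUP sPN] := inv_quotientS nUN (pHall_sub sylS).
  move=> /(_ P); have nUP : U <| P by apply: normalS nUN.
  rewrite -defS (pHall_pgroup sylS) sum_joing_max // => /(_ nUP).
  case=> // [|e E]; first by rewrite (subset_trans sPN) ?subsetIl.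
  exists e; apply: (mulfI (subG_nz sUG)); rewrite E mulrCA -natrM.
  rewrite -(card_Hall sylS) /= defS card_quotient ?normal_norm // Lagrange //.
pose d' H := d H - c * (gmark G U H)%:R.
have d'sub H : d' H != 0 -> exists2 H' : {group gT}, H \subset H' & d H' != 0.
  move=> nz; have [z|z] := eqVneq (d H) 0; last by exists H.
  have: gmark G U H != 0%N by apply: contraNneq nz; rewrite /d' z => ->; rewrite mulr0 subr0.
  case/gmark_neq0=> // g Gg sH; exists (U :^ g^-1%g)%G; last by rewrite dJ ?groupV.
  by rewrite -sub_conjg.
have [||||r [rsub Er]] := IH d'.
- rewrite -ltnS; apply: leq_trans le; apply: proper_card; rewrite properE; apply/andP; split.
    apply/subsetP=> H; rewrite !inE => /existsP[H' /andP[sH /d'sub[H'' sH' nz]]].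
    by apply/existsP; exists H''; rewrite (subset_trans sH).
  apply/subsetPn; exists U; rewrite inE; first by apply/existsP; exists U; rewrite subxx.
  apply/existsP=> -[H /andP[sUH nzH]]; have [H' sH nzH'] := d'sub H nzH.
  have eH' : U :=: H' by apply/eqP; rewrite eqEcard (subset_trans sUH) //; apply: maxU.
  have eH : H = U by apply/val_inj/eqP; rewrite eqEsubset sUH andbT /= eH'.
  by move: nzH; rewrite eH /d' Ec subrr eqxx.
- by move=> H g Gg; rewrite /d' dJ // gmarkJr.
- move=> H nHG; apply/eqP; rewrite -[_ == _]negbK; apply/negP => /d'sub[H' sH]; apply/negP.
  by rewrite negbK dG //; apply: contra nHG; apply: subset_trans.
- move=> p pr_p dvp; have [|dvd_d] := dp p pr_p dvp; [by left | right => V P nVP sPG pP].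
  have [a Ea] := dvd_d V P nVP sPG pP.
  have /dvdnP[b Eb] := mark_burnside sUG nVP sPG.
  exists (a - c * b%:R); rewrite /d' sumrB Ea mulrBl; congr (_ - _).
  by rewrite -mulr_sumr -natr_sum Eb natrM mulrA.
exists (r + gdelta U c); split=> [L|H sHG].
  rewrite !ffunE; case: (L =P U) => [->|_]; first by exists U.
  by rewrite addr0 => /rsub[H sLH /d'sub[H' sH nz]]; exists H' => //; apply: subset_trans sLH sH.
by rewrite gmkD gmk_delta // Er // /d' subrK.
Qed.

(* The factor |G| kills all congruence obstructions. *)
Lemma marks_surj_scaled (d : {group gT} -> R) :
    (forall H g, g \in G -> d (H :^ g)%G = d H) ->
    (forall H, ~~ (H \subset G) -> d H = 0) ->
  exists r : {ffun {group gT} -> R},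
    (forall L, r L != 0 -> exists2 H : {group gT}, L \subset H & d H != 0) /\
    (forall H, H \subset G -> gmk G r H = #|G|%:R * d H).
Proof.
move=> dJ dG; have [|||r [rsub Er]] := @marks_surj (fun H => #|G|%:R * d H).
- by move=> H g Gg; rewrite dJ.
- by move=> H /dG->; rewrite mulr0.
- move=> p _ _; right => U P _ sPG _; rewrite -mulr_sumr.
  have /dvdnP[k ->] := cardSg sPG; exists (k%:R * \sum_(g in P) d (U <*> <[g]>)%G).
  by rewrite natrM mulrAC.
exists r; split=> // L /rsub[H sLH]; rewrite mulf_eq0 negb_or => /andP[_ nz].
by exists H.
Qed.

End MarkSurj.

(* Marks separate points modulo conjugation, so only the class sums of x are seen by
   conjugation-invariant weights. *)
Lemma gmk0_sum (gT : finGroupType) (G : {group gT}) (K : fieldType)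
    (x : {ffun {group gT} -> K}) (w : {group gT} -> K) :
    #|G|%:R != 0 :> K ->
    (forall H : {group gT}, H \subset G -> gmk G x H = 0) ->
    (forall (H : {group gT}) g, H \subset G -> g \in G -> w (H :^ g)%G = w H) ->
  \sum_(U : {group gT} | U \subset G) x U * w U = 0.
Proof.
move=> nzG x0 wJ.
pose s (U : {group gT}) := \sum_(g in G) x (U :^ g)%G.
have avg (v : {group gT} -> K) :
    (forall (H : {group gT}) g, H \subset G -> g \in G -> v (H :^ g)%G = v H) ->
  #|G|%:R * (\sum_(U : {group gT} | U \subset G) x U * v U) =
  \sum_(U : {group gT} | U \subset G) s U * v U.
  move=> vJ; rewrite mulr_natl -sumr_const.
  rewrite [RHS](eq_bigr (fun U : {group gT} => \sum_(g in G) x (U :^ g)%G * v U)) => [|U _];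
    last by rewrite /s mulr_suml.
  rewrite [RHS]exchange_big /=; apply: eq_bigr => g Gg.
  rewrite (reindex_inj (h := fun U : {group gT} => (U :^ g)%G)); last first.
    by move=> A B /(congr1 val)/conjsg_inj/val_inj.
  by apply: eq_big => U /=; rewrite conjG_sub // => sU; rewrite vJ.
suff s0 (U : {group gT}) : U \subset G -> s U = 0.
  by apply: (mulfI nzG); rewrite avg // mulr0 big1 // => U /s0->; rewrite mul0r.
move=> sUG; apply/eqP; apply: contraT => nzU.
have nzU' : (U \subset G) && (s U != 0) by rewrite sUG.
(* At a largest L with nonzero class sum only conjugates of L contribute to the mark, so |G| [s L]
   is |L| times a sum of marks that vanishes. *)
case: (@arg_maxnP _ U (fun U : {group gT} => (U \subset G) && (s U != 0)) (fun U : {group gT} =>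
  #|U|) nzU')
  => L /andP[sLG nzL] maxL.
have nzc : #|L|%:R != 0 :> K.
  by have /dvdnP[k E] := cardSg sLG; apply: contraNneq nzG; rewrite E natrM => ->; rewrite mulr0.
have E : \sum_(V : {group gT} | V \subset G) s V * (gmark G V L)%:R = 0.
  rewrite -(avg (fun V => (gmark G V L)%:R)) => [|H g sHG Gg]; last by rewrite gmarkJl.
  by have := x0 L sLG; rewrite /gmk => ->; rewrite mulr0.
have : #|G|%:R * s L = 0.
  have -> : #|G|%:R * s L = #|L|%:R * \sum_(V : {group gT} | V \subset G) s V * (gmark G V L)%:R.
    have -> : #|G|%:R * s L = \sum_(g in G) s (L :^ g)%G.
      rewrite mulr_natl -sumr_const; apply: eq_bigr => g Gg; rewrite /s.
      rewrite [LHS](reindex_inj (mulgI g)) /=; apply: eq_big => [h|h Gh];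
        first by rewrite groupMl.
      by congr (x _); apply: val_inj; rewrite /= conjsgM.
    rewrite mulr_sumr (partition_big (fun g => (L :^ g)%G) (fun V : {group gT} =>
      V \subset G)) /=; last first.
      by move=> g Gg /=; rewrite conjG_sub.
    apply: eq_bigr => V sVG.
    rewrite (eq_bigr (fun=> s V)) => [|g /andP[_ /eqP->]//].
    have [->|nzV] := eqVneq (s V) 0; first by rewrite big1 // mul0r mulr0.
    have leV : (#|V| <= #|L|)%N by apply: maxL; rewrite sVG.
    rewrite sumr_const -[LHS]mulr_natl [RHS]mulrCA [LHS]mulrC; congr (_ * _).
    rewrite -natrM; congr (_%:R).
    have [E0|nz] := eqVneq (gmark G V L) 0%N.
      rewrite E0 muln0; apply: eq_card0 => g; rewrite -topredE /=; apply/andP=> -[Gg /eqP Vg].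
      have := mark_count L sVG; rewrite E0 muln0 => /esym/eqP; rewrite cards_eq0 =>
        /eqP/setP/(_ g).
      by rewrite !inE Gg -Vg /= subxx.
    have [h Gh sh] := gmark_neq0 sVG nz.
    have eqc : #|L| = #|V| by apply/eqP; rewrite eqn_leq leV andbT -(cardJg L h) subset_leq_card.
    rewrite eqc mark_count //; apply: eq_card => g; rewrite inE -topredE /=; congr (_ && _).
    rewrite -val_eqE /= eqEcard cardJg eqc leqnn andbT.
    by [].
  by rewrite E mulr0.
by move/eqP; rewrite mulf_eq0 (negbTE nzG) (negbTE nzL).
Qed.

(** * Products of bifree bisets as convolutions over twisted diagonals *)

Section Bisets.
Local Open Scope group_scope.
Variables (gT : finGroupType) (G : {group gT}).
Implicit Types (L M N A B : {group gT * gT}) (H U : {group gT}).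

Definition GGg : {group gT * gT} := setX_group G G.

Lemma pairM (a b c d : gT) : (a, b) * (c, d) = (a * c, b * d). Proof. by []. Qed.
Lemma pairV (a b : gT) : (a, b)^-1 = (a^-1, b^-1). Proof. by []. Qed.
Lemma pairJ (a b c d : gT) : (a, b) ^ (c, d) = (a ^ c, b ^ d). Proof. by rewrite !conjgE. Qed.

Lemma memGG a b : ((a, b) \in GGg) = (a \in G) && (b \in G).
Proof. by rewrite in_setX. Qed.

(** Subgroups of G x G are read as relations: [relV] is the opposite relation and [relM] the
    composite, as in the Mackey formula for bisets. *)
Definition relV (L : {set gT * gT}) := [set n : gT * gT | (n.2, n.1) \in L].
Definition relM (L M : {set gT * gT}) :=
  [set n : gT * gT | [exists b, ((n.1, b) \in L) && ((b, n.2) \in M)]].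

Lemma relMP (L M : {set gT * gT}) x y :
  reflect (exists2 b, (x, b) \in L & (b, y) \in M) ((x, y) \in relM L M).
Proof. by rewrite inE; apply: (iffP existsP) => -[b] => [/andP[]|]; exists b => //;
  apply/andP. Qed.

Lemma relVE (L : {set gT * gT}) x y : ((x, y) \in relV L) = ((y, x) \in L).
Proof. by rewrite inE. Qed.

Lemma relV_group_set L : group_set (relV L).
Proof.
apply/group_setP; split=> [|[a b] [c d]]; first by rewrite relVE group1.
by rewrite !relVE => La Lc; rewrite (groupM La Lc).
Qed.
Canonical relV_group L := group (relV_group_set L).

Lemma relM_group_set L M : group_set (relM L M).
Proof.
apply/group_setP; split=> [|[a b] [c d]]; first by apply/relMP; exists 1; rewrite group1.
case/relMP=> x Lx Mx /relMP[y Ly My]; apply/relMP; exists (x * y).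
  by rewrite -pairM groupM.
by rewrite -pairM groupM.
Qed.
Canonical relM_group L M := group (relM_group_set L M).

Lemma mem_p1 N x : reflect (exists y, (x, y) \in N) (x \in fst @* N).
Proof.
apply: (iffP morphimP) => [[[a y] _ Nn ->]|[y Ny]]; first by exists y.
by exists (x, y).
Qed.

Lemma mem_p2 N y : reflect (exists x, (x, y) \in N) (y \in snd @* N).
Proof.
apply: (iffP morphimP) => [[[x a] _ Nn ->]|[x Nx]]; first by exists x.
by exists (x, y).
Qed.

(** Trivial [k1] and [k2] say that N is a twisted diagonal: the graph of an isomorphism from its
    source [snd @* N] onto its target [fst @* N]. *)
Lemma bifreeP N : reflect [/\ N \subset GGg, forall x, (x, 1) \in N -> x = 1
    & forall x, (1, x) \in N -> x = 1] (bifree G N).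
Proof.
apply: (iffP and3P) => [[sN /eqP E1 /eqP E2]|[sN E1 E2]].
  by split=> // x Nx; apply/set1gP; [rewrite -E1 inE | rewrite -E2 inE].
split=> //; apply/eqP/setP=> x; rewrite !inE.
  by apply/idP/eqP=> [/E1//|->]; apply: group1.
by apply/idP/eqP=> [/E2//|->]; apply: group1.
Qed.

Lemma bifree_sub N : bifree G N -> N \subset GGg.
Proof. by case/bifreeP. Qed.

Lemma bifree_inj1 N x x' y : bifree G N -> (x, y) \in N -> (x', y) \in N -> x = x'.
Proof.
case/bifreeP=> _ E _ Nx Nx'; have := groupM Nx (groupVr Nx').
by rewrite pairV pairM mulgV => /E/eqP; rewrite -eq_mulgV1 => /eqP.
Qed.

Lemma bifree_inj2 N x y y' : bifree G N -> (x, y) \in N -> (x, y') \in N -> y = y'.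
Proof.
case/bifreeP=> _ _ E Nx Nx'; have := groupM Nx (groupVr Nx').
by rewrite pairV pairM mulgV => /E/eqP; rewrite -eq_mulgV1 => /eqP.
Qed.

Lemma bifreeS N L : N \subset L -> bifree G L -> bifree G N.
Proof.
move=> sNL /bifreeP[sL E1 E2]; apply/bifreeP; split; first exact: subset_trans sL.
  by move=> x /(subsetP sNL)/E1.
by move=> x /(subsetP sNL)/E2.
Qed.

Lemma memJ_pair L (x y a b : gT) : ((x, y) \in L :^ (a, b)) = ((x ^ a^-1, y ^ b^-1) \in L).
Proof. by rewrite mem_conjg pairV pairJ. Qed.

Lemma bifreeJ N g : g \in GGg -> bifree G N -> bifree G (N :^ g).
Proof.
case: g => a b gG /bifreeP[sN E1 E2]; apply/bifreeP; split; first by rewrite conjG_sub.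
  by move=> x; rewrite memJ_pair conj1g => /E1/eqP; rewrite conjg_eq1 => /eqP.
by move=> x; rewrite memJ_pair conj1g => /E2/eqP; rewrite conjg_eq1 => /eqP.
Qed.

Lemma bifreeM N M : bifree G N -> bifree G M -> bifree G (relM N M).
Proof.
move=> fN fM; case/bifreeP: (fN) => sN _ _; case/bifreeP: (fM) => sM _ _.
apply/bifreeP; split.
- apply/subsetP=> -[x y] /relMP[b /(subsetP sN) + /(subsetP sM)].
  by rewrite !memGG => /andP[-> _] /andP[].
- move=> x /relMP[b Nb Mb]; have b1 := bifree_inj1 fM Mb (group1 M).
  by rewrite b1 in Nb; apply: (bifree_inj1 fN Nb (group1 N)).
- move=> x /relMP[b Nb Mb]; have b1 := bifree_inj2 fN Nb (group1 N).
  by rewrite b1 in Mb; apply: (bifree_inj2 fM Mb (group1 M)).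
Qed.

Lemma bifreeV N : bifree G N -> bifree G (relV N).
Proof.
case/bifreeP=> sN E1 E2; apply/bifreeP; split.
- by apply/subsetP=> -[x y]; rewrite relVE => /(subsetP sN); rewrite !memGG andbC.
- by move=> x; rewrite relVE => /E2.
- by move=> x; rewrite relVE => /E1.
Qed.

(** The inverses make a right action out of the left action behind [orbG]; the orbits are the
    same. *)
Definition pact (p : pt gT) (g : gT) : pt gT := ((1, g^-1) *: p.1, (g^-1, 1) *: p.2).

Lemma pact1 : pact^~ 1 =1 id.
Proof. by case=> C D; rewrite /pact invg1 !lcoset1. Qed.

Lemma pactM p : act_morph pact p.
Proof. by move=> a b; rewrite /pact /= -!lcosetM !pairM !mulg1 invMg. Qed.

Definition pact_action := TotalAction pact1 pactM.

Lemma orbGE p : orbG G p = orbit pact_action G p.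
Proof.
apply/setP=> q; apply/imsetP/orbitP => -[g Gg E].
  by exists g^-1; rewrite ?groupV //= /pact invgK E.
by exists g^-1; rewrite ?groupV // -E.
Qed.

(** Invariance of the G-orbit of p under n means that n moves p to another point of the orbit; the
    element g of G doing so is absorbed into the stabilizers of both coordinates. *)
Definition pfix (p : pt gT) (N : {set gT * gT}) :=
  [forall n in N, [exists g in G, ((n.1, g) *: p.1 == p.1) && ((g, n.2) *: p.2 == p.2)]].

Lemma orb_fix p N :
  [forall n in N, actLR n (orbG G p) == orbG G p] = pfix p N.
Proof.
apply: eq_forallb_in => -[a b] _ /=.
have -> : actLR (a, b) (orbG G p) = orbG G ((a, 1) *: p.1, (1, b) *: p.2).
  rewrite /actLR /orbG -imset_comp; apply: eq_imset => g /=.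
  by rewrite -!lcosetM !pairM !mul1g !mulg1.
rewrite !orbGE; apply/eqP/exists_inP.
  move=> /orbit_eqP; rewrite -orbGE => /imsetP[g Gg [E1 E2]].
  exists g^-1; rewrite ?groupV //; apply/andP; split; apply/eqP.
    have -> : (a, g^-1) = (1, g^-1) * (a, 1) by rewrite pairM mul1g mulg1.
    by rewrite lcosetM E1 -lcosetM pairM mulVg mul1g lcoset1.
  have -> : (g^-1, b) = (g^-1, 1) * (1, b) by rewrite pairM mul1g mulg1.
  by rewrite lcosetM E2 -lcosetM pairM mulVg mul1g lcoset1.
case=> g Gg /andP[/eqP E1 /eqP E2]; apply/orbit_eqP; rewrite -orbGE; apply/imsetP.
exists g^-1; rewrite ?groupV //; congr (_, _).
  by rewrite -[in RHS]E1 -lcosetM pairM mul1g mulVg.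
by rewrite -[in RHS]E2 -lcosetM pairM mul1g mulVg.
Qed.

Lemma lcosets_GG L (C : {set gT * gT}) n : L \subset GGg -> n \in GGg ->
  C \in lcosets L (GG G) -> n *: C \in lcosets L (GG G).
Proof.
move=> sL Gn /lcosetsP[z Gz ->]; rewrite -lcosetM (mem_lcosets L GGg) (mulGSid sL) groupM //.
Qed.

(** G acts freely on the first coordinate because [k2 L] is trivial, so every orbit consists of
    exactly |G| pairs. *)
Lemma prodmark_pairs L M N : bifree G L -> M \subset GGg ->
  (#|G| * prodmark G L M N =
  \sum_(C in lcosets L (GG G)) \sum_(D in lcosets M (GG G)) pfix (C, D) N)%N.
Proof.
move=> fL sM; have sL := bifree_sub fL.
rewrite pair_big_dep /= (eq_bigl (mem (setX (lcosets L (GG G)) (lcosets M (GG G))))); last first.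
  by case=> C D; rewrite !inE.
rewrite (partition_big (fun p => orbG G p) (mem (orbs G L M))) /=; last first.
  by move=> p Xp; apply: imset_f.
rewrite /prodmark -sum1dep_card big_mkcondr /= big_distrr /=.
apply: eq_bigr => _ /imsetP[[C0 D0] Xp ->].
rewrite (eq_bigr (fun=> pfix (C0, D0) N : nat)); last first.
  case=> C D /andP[_ /eqP E]; congr (nat_of_bool _).
  by rewrite -!orb_fix E.
rewrite sum_nat_const orb_fix; case: (pfix (C0, D0) N); last by rewrite !muln0.
rewrite !muln1.
transitivity #|orbG G (C0, D0)|.
  rewrite card_in_imset // => g h Gg Gh /(congr1 fst) /=.
  move: Xp; rewrite in_setX => /andP[/lcosetsP[z Gz ->] _] /(congr1 (lcoset^~ (1, h)^-1)).
  rewrite !lcosetE -lcosetM -[in RHS]lcosetM mulVg lcoset1 -lcosetM => /eqP.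
  rewrite lcosetM lcoset_fix pairV pairM.
  case: z Gz => z1 z2 Gz; rewrite pairJ mulg1 invg1 conj1g.
  case/bifreeP: fL => _ _ E2 /E2/eqP; rewrite conjg_eq1 -eq_mulVg1 => /eqP->//.
apply: eq_card => q; rewrite [RHS]unfold_in /= !orbGE.
apply/idP/andP => [qp|[_ /eqP E]]; last by rewrite -E orbit_refl.
split; last by apply/eqP/orbit_eqP.
move: qp Xp; rewrite -orbGE => /imsetP[g Gg ->]; rewrite !in_setX /= => /andP[XC XD].
by rewrite !lcosets_GG // memGG group1 Gg.
Qed.

(** For twisted diagonals A and B, N lies in the composite of A and B exactly when N factors as (N
    M^-1) M with factors inside A and B. Such an M with the source of N is unique, namely A^-1 N, so
    the indicator equals a sum with at most one nonzero term. *)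
Lemma pfix_sum A B N : bifree G A -> bifree G B ->
  let c n := [exists g in G, ((n.1, g) \in A) && ((g, n.2) \in B)] in
  ([forall n in N, c n] -> bifree G N) /\
  (bifree G N -> ([forall n in N, c n] : nat) =
    \sum_(M : {group gT * gT} | bifree G M && (snd @* M == snd @* N)%g)
      ((relM N (relV M) \subset A) && (M \subset B)))%N.
Proof.
move=> fA fB c; have sA := bifree_sub fA; have sB := bifree_sub fB.
have cP n : reflect (exists2 g, (n.1, g) \in A & (g, n.2) \in B) (c n).
  apply: (iffP exists_inP) => [[g _ /andP[]]|[g Ag Bg]]; first by exists g.
  by exists g; rewrite ?Ag //; move/(subsetP sA): Ag; rewrite memGG => /andP[].
have NE : [forall n in N, c n] = (N \subset relM A B).
  apply/forall_inP/subsetP => [H [x y] /H/cP|H [x y] /H/relMP]; last by move=> ?; apply/cP.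
  by case=> g Ag Bg; apply/relMP; exists g.
split=> [|fN]; first by rewrite NE => sN; apply: bifreeS sN (bifreeM fA fB).
have E (M : {group gT * gT}) : bifree G M && (snd @* M == snd @* N) &&
    ((relM N (relV M) \subset A) && (M \subset B)) =
    (M == relM_group (relV_group A) N) && [forall n in N, c n].
  rewrite NE; apply/idP/idP; last first.
    case/andP=> /eqP-> sN.
    have fM : bifree G (relM (relV A) N) by apply: bifreeM fN; apply: bifreeV.
    rewrite fM /=; apply/and3P; split.
    - apply/eqP/setP=> y; apply/mem_p2/mem_p2 => -[x].
        by case/relMP=> b _; exists b.
      move=> Nx; have /relMP[g Ag Bg] := subsetP sN _ Nx.
      by exists g; apply/relMP; exists x; rewrite ?relVE.
    - apply/subsetP=> -[x g] /relMP[y Nx]; rewrite relVE => /relMP[x']; rewrite relVE => Ax' Nx'.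
      by rewrite (bifree_inj1 fN Nx Nx').
    - apply/subsetP=> -[g y] /relMP[x]; rewrite relVE => Ax Nx.
      have /relMP[g' Ag' Bg'] := subsetP sN _ Nx.
      by rewrite (bifree_inj2 fA Ax Ag').
  case/andP=> /andP[fM /eqP EM] /andP[sNM sMB]; apply/andP; split.
    rewrite -val_eqE /=; apply/eqP/setP=> -[g y]; apply/idP/relMP.
      move=> My; have: y \in snd @* N by rewrite -EM; apply/mem_p2; exists g.
      case/mem_p2=> x Nx; exists x => //; rewrite relVE; apply: (subsetP sNM).
      by apply/relMP; exists y; rewrite ?relVE.
    case=> x; rewrite relVE => Ax Nx; have: y \in snd @* M by rewrite EM; apply/mem_p2; exists x.
    case/mem_p2=> g' Mg'; suff -> : g = g' by [].
    apply: (bifree_inj2 fA Ax); apply: (subsetP sNM).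
    by apply/relMP; exists y; rewrite ?relVE.
  apply/subsetP=> -[x y] Nx; have: y \in snd @* M by rewrite EM; apply/mem_p2; exists x.
  case/mem_p2=> g Mg; apply/relMP; exists g; last exact: (subsetP sMB).
  by apply: (subsetP sNM); apply/relMP; exists y; rewrite ?relVE.
rewrite big_mkcond /= (eq_bigr (fun M => ((M == relM_group (relV_group A) N) && [forall n in N,
  c n]) : nat)).
  rewrite (bigD1 (relM_group (relV_group A) N)) //= eqxx big1 ?addn0 // => M /negbTE->.
  by [].
by move=> M _; rewrite -E; case: ifP.
Qed.

(** Summed over all pairs of cosets, the unique factorization separates the two coordinates and
    leaves products of ordinary marks. *)
Lemma prodmark_conv L M N : bifree G L -> bifree G M ->
  (prodmark G L M N != 0%N -> bifree G N) /\
  (bifree G N -> (#|G| * prodmark G L M N =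
     \sum_(M' : {group gT * gT} | bifree G M' && (snd @* M' == snd @* N)%g)
        bmark G L (relM N (relV M')) * bmark G M M')%N).
Proof.
move=> fL fM; have sL := bifree_sub fL; have sM := bifree_sub fM.
have fixE (P : {group gT * gT}) z n : (n *: (z *: P) == z *: P) = (n \in P :^ z^-1).
  by rewrite lcoset_fix mem_conjgV.
have key C D : C \in lcosets L (GG G) -> D \in lcosets M (GG G) ->
   (pfix (C, D) N -> bifree G N) /\
   (bifree G N -> (pfix (C, D) N : nat) =
     \sum_(M' : {group gT * gT} | bifree G M' && (snd @* M' == snd @* N)%g)
      ([forall n in relM N (relV M'), n *: C == C] && [forall n in M', n *: D == D])%g)%N.
  case/lcosetsP=> z Gz -> /lcosetsP[w Gw ->].
  have fA := bifreeJ (groupVr Gz : z^-1 \in GGg) fL.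
  have fB := bifreeJ (groupVr Gw : w^-1 \in GGg) fM.
  have pE : pfix (z *: L, w *: M) N =
     [forall n in N, [exists g in G, ((n.1, g) \in L :^ z^-1) && ((g, n.2) \in M :^ w^-1)]].
    by apply: eq_forallb_in => n _; apply: eq_existsb_in => g _; rewrite /= !fixE.
  have [H1 H2] := pfix_sum N fA fB; rewrite pE; split=> // fN; rewrite (H2 fN).
  by apply: eq_bigr => M' _; rewrite !lcoset_fix_sub !sub_conjg.
split=> [|fN].
  rewrite -lt0n -(ltn_pmul2l (cardG_gt0 G)) muln0 lt0n prodmark_pairs // sum_nat_eq0 negb_forall.
  case/existsP=> C; rewrite negb_imply => /andP[XC]; rewrite sum_nat_eq0 negb_forall.
  case/existsP=> D; rewrite negb_imply => /andP[XD]; rewrite eqb0 negbK.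
  by case: (key C D XC XD).
rewrite prodmark_pairs //.
under eq_bigr => C XC do under eq_bigr => D XD do rewrite (proj2 (key C D XC XD) fN).
under eq_bigr => C XC do rewrite exchange_big.
rewrite exchange_big; apply: eq_bigr => M' _ /=.
rewrite /bmark -!sum1dep_card big_mkcondr [in RHS]big_mkcondr /= big_distrlr /=.
apply: eq_bigr => C _; apply: eq_bigr => D _.
by case: ifP; case: ifP.
Qed.

End Bisets.

(** * Marks of products and of Delta(x) *)

Section Convolution.
Local Open Scope group_scope.
Local Open Scope ring_scope.
Variables (gT : finGroupType) (G : {group gT}).
Implicit Types (L M N A B : {group gT * gT}) (H U : {group gT}).

Lemma lcosets_conj L a (C : {set gT * gT}) :
  a \in GGg G -> (C :* a \in lcosets (L :^ a) (GG G)) = (C \in lcosets L (GG G)).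
Proof.
move=> Ga; apply/lcosetsP/lcosetsP => -[z Gz E].
  exists (z * a^-1)%g; first by rewrite (groupM (G := GGg G)) ?groupV.
  by rewrite -(rcosetK a C) E conjsgE -!mulgA mulg_set1 mulgV mulg1 lcosetM.
exists (z * a)%g; first by rewrite (groupM (G := GGg G)).
by rewrite E conjsgE -lcosetM mulgK -mulgA.
Qed.

(** Right translation by a identifies the cosets of L with those of its conjugate and commutes with
    all left actions. Hence [prodmark] is a conjugation-invariant weight in L and in M, as
    [gmk0_sum] requires. *)
Lemma prodmarkJ L M N a b : a \in GGg G -> b \in GGg G ->
  prodmark G (L :^ a) (M :^ b) N = prodmark G L M N.
Proof.
move=> Ga Gb; pose f (p : pt gT) : pt gT := (p.1 :* a, p.2 :* b).
have f_inj : injective f by case=> C D [C' D'] [/rcoset_inj-> /rcoset_inj->].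
have orbf p : orbG G (f p) = f @: orbG G p.
  by rewrite /orbG -imset_comp; apply: eq_imset => g /=; rewrite /f /= !mulgA.
have actf n (O : {set pt gT}) : actLR n (f @: O) = f @: actLR n O.
  by rewrite /actLR -!imset_comp; apply: eq_imset => p /=; rewrite /f /= !mulgA.
rewrite /prodmark -[RHS](card_imset _ (imset_inj f_inj)); apply: eq_card => O.
rewrite inE; apply/andP/imsetP => [[/imsetP[[C D]]]|[O']].
  rewrite in_setX => /andP[/= XC XD] EO /forall_inP fixO.
  have Ef : (C, D) = f (C :* a^-1, D :* b^-1)%g by rewrite /f /= !rcosetKV.
  exists (orbG G (C :* a^-1, D :* b^-1)%g); last by rewrite EO Ef orbf.
  rewrite inE imset_f /=; last first.
    by rewrite in_setX /= -(lcosets_conj L _ Ga) -(lcosets_conj M _ Gb) !rcosetKV XC.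
  apply/forall_inP=> n Nn; have := fixO n Nn; rewrite EO Ef orbf actf.
  by move/eqP/(imset_inj f_inj)/eqP.
rewrite inE => /andP[/imsetP[p Xp EO'] /forall_inP fixO] ->; split.
  rewrite EO' -orbf imset_f //; case: p Xp {EO'} => C D; rewrite !in_setX /=.
  by rewrite !lcosets_conj.
by apply/forall_inP=> n Nn; rewrite actf (eqP (fixO n Nn)).
Qed.

Section Ring.
Variable K : nzRingType.
Implicit Types x y z : {ffun {group gT * gT} -> K}.

Lemma bmkE x (N : {set gT * gT}) : bmk G x N = gmk (GGg G) x N.
Proof. by []. Qed.

Lemma bmkD x y (N : {set gT * gT}) : bmk G (x + y) N = bmk G x N + bmk G y N.
Proof. by rewrite !bmkE gmkD. Qed.

Lemma bmkN x (N : {set gT * gT}) : bmk G (- x) N = - bmk G x N.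
Proof. by rewrite !bmkE gmkN. Qed.

Lemma bmk0 (N : {set gT * gT}) : bmk G (0 : {ffun {group gT * gT} -> K}) N = 0.
Proof. by rewrite !bmkE gmk0. Qed.

Lemma bmkJ x (N : {set gT * gT}) k : k \in GGg G -> bmk G x (N :^ k) = bmk G x N.
Proof. by move=> Gk; rewrite !bmkE gmkJ. Qed.

Lemma pmkBl x x' y N : pmk G (x - x') y N = pmk G x y N - pmk G x' y N.
Proof.
rewrite /pmk -sumrB; apply: eq_bigr => L _; rewrite -sumrB; apply: eq_bigr => M _.
by rewrite !ffunE !mulrBl.
Qed.

Lemma pmkBr x y y' N : pmk G x (y - y') N = pmk G x y N - pmk G x y' N.
Proof.
rewrite /pmk -sumrB; apply: eq_bigr => L _; rewrite -sumrB; apply: eq_bigr => M _.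
by rewrite !ffunE !(mulrBl, mulrBr).
Qed.

Definition bsupp x := forall L, x L != 0 -> bifree G L.

Lemma bsuppN0 x L : bsupp x -> ~~ bifree G L -> x L = 0.
Proof. by move=> sx; apply: contraNeq => /sx. Qed.

Lemma bmk_bifree x N : bsupp x -> ~~ bifree G N -> bmk G x N = 0.
Proof.
move=> sx nN; rewrite /bmk big1 // => L sL.
have [/sx fL|/negbNE/eqP->] := boolP (x L != 0); last by rewrite mul0r.
suff -> : bmark G L N = 0%N by rewrite mulr0.
apply/eqP; apply: contraR nN => /(@gmark_neq0 _ (GGg G) _ _ sL)[g Gg sN].
by rewrite -(conjsgK g N); apply: (bifreeJ (groupVr Gg)); apply: (@bifreeS _ _ (N :^ g)%G L).
Qed.

(* It is |C_G(snd @* N)| if N is the restriction of an inner automorphism of G and 0 otherwise,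
   so the marks of Delta(x) at N are ucount N times those of x, without case distinction. *)
Definition ucount (N : {set gT * gT}) : nat :=
  #|[set g in G | [forall n in N, n.1 == (n.2 ^ g)%g]]|.

Lemma diag_group_set U : group_set (diag U).
Proof.
apply/group_setP; split=> [|x y /imsetP[a Ua ->] /imsetP[b Ub ->]].
  by apply/imsetP; exists 1%g.
by apply/imsetP; exists (a * b)%g; rewrite ?groupM.
Qed.
Canonical diag_group U := group (diag_group_set U).

Lemma mem_diag (U : {set gT}) (x y : gT) : ((x, y) \in diag U) = (x == y) && (y \in U).
Proof.
apply/imsetP/andP => [[u Uu [-> ->]]|[/eqP-> Uy]]; first by rewrite eqxx.
by exists y.
Qed.

Lemma card_diag (U : {set gT}) : #|diag U| = #|U|.
Proof. by rewrite card_imset // => u v []. Qed.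

Lemma diag_bifree U : U \subset G -> bifree G (diag_group U).
Proof.
move=> sUG; apply/bifreeP; split.
- by apply/subsetP=> -[x y]; rewrite mem_diag memGG => /andP[/eqP-> /(subsetP sUG)->].
- by move=> x; rewrite mem_diag => /andP[/eqP].
- by move=> x; rewrite mem_diag => /andP[/eqP].
Qed.

Lemma snd_diag U : snd @* diag U = U.
Proof.
apply/setP=> y; apply/(@mem_p2 _ (diag_group U))/idP => [[x]|Uy].
  by rewrite mem_diag => /andP[].
by exists y; rewrite mem_diag eqxx.
Qed.

(** (a, b) conjugates N into Delta(U) exactly when b a^-1 induces N and b conjugates the source of N
    into U. The two conditions are independent, so the count is a product. *)
Lemma bmark_diag U N : U \subset G ->
  bmark G (diag U) N = (ucount N * gmark G U (snd @* N))%N.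
Proof.
move=> sUG; have sD := bifree_sub (diag_bifree sUG).
apply/eqP; rewrite -(eqn_pmul2l (cardG_gt0 U)) mulnCA mark_count // -{1}card_diag.
rewrite (mark_count (G := GGg G) (U := diag_group U)) //.
rewrite -cardsX -(card_imset (setX _ _) (f := fun p : gT * gT => (p.1^-1 * p.2, p.2)%g));
  last first.
  by case=> a b [c d] [+ E]; rewrite /= E => /mulIg/invg_inj->.
apply/eqP/eq_card => -[a b]; rewrite inE; apply/andP/imsetP.
  rewrite memGG => -[/andP[Ga Gb] /subsetP sN].
  have xy (x y : gT) : (x, y) \in N -> (x ^ a == y ^ b)%g /\ (y ^ b \in U)%g.
    move=> Nxy; have := sN ((x, y) ^ (a, b))%g; rewrite memJ_conjg pairJ mem_diag.
    by move=> /(_ Nxy)/andP[].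
  exists (b * a^-1, b)%g; last by rewrite /= invMg invgK mulgKV.
  rewrite in_setX !inE /= groupM ?groupV //= Gb /=; apply/andP; split.
    by apply/forall_inP=> -[x y] /xy[/eqP E _]; rewrite /= conjgM -E conjgK.
  by apply/subsetP=> _ /imsetP[y /mem_p2[x /xy[_ Uy]] ->].
case=> -[g c]; rewrite in_setX !inE /= => /andP[/andP[Gg /forall_inP gN] /andP[Gc /subsetP sU]]
  [-> ->].
rewrite groupM ?groupV // Gc; split=> //.
apply/subsetP=> -[x y]; rewrite memJ_pair => Nxy.
have /eqP := gN _ Nxy; rewrite /= => E; rewrite mem_diag; apply/andP; split.
  move/eqP: E; rewrite invMg invgK conjgM => /eqP/conjg_inj E.
  by rewrite -(inj_eq (conjg_inj c^-1)%g) E.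
have := sU y; rewrite mem_conjg; apply; apply/mem_p2.
by eexists; apply: Nxy.
Qed.

Lemma bmk_Dlt (x : {ffun {group gT} -> K}) N :
  bmk G (Dlt G x) N = (ucount N)%:R * gmk G x (snd @* N).
Proof.
rewrite /bmk /gmk.
transitivity (\sum_(U : {group gT} | U \subset G) x U * (bmark G (diag U) N)%:R).
  under eq_bigr => L sL do rewrite ffunE mulr_suml.
  rewrite (exchange_big_dep (fun U : {group gT} => U \subset G)) /=; last by move=> L U _ /andP[].
  apply: eq_bigr => U sU; rewrite (big_pred1 (diag_group U)) // => L /=.
  have -> : (L == diag_group U) = ((L : {set gT * gT}) == diag U) by [].
  rewrite sU /=; case: (_ =P diag U) => [->|]; last by rewrite andbF.
  by rewrite (bifree_sub (diag_bifree sU)).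
rewrite mulr_sumr; apply: eq_bigr => U sU.
by rewrite bmark_diag // natrM -commr_nat mulrA commr_nat.
Qed.

Lemma bsupp_Dlt (x : {ffun {group gT} -> K}) : bsupp (Dlt G x).
Proof.
move=> L; rewrite ffunE; case: (pickP (fun U : {group gT} =>
  (U \subset G) && ((L : {set gT * gT}) == diag U))).
  by move=> U /andP[sU /eqP E] _; have := diag_bifree sU; rewrite /bifree /= E.
by move=> z; rewrite big_pred0 ?eqxx.
Qed.

End Ring.

Section Field.
Variable K : fieldType.
Hypothesis nzG : #|G|%:R != 0 :> K.
Implicit Types x y z : {ffun {group gT * gT} -> K}.

Lemma nzGG : #|GGg G|%:R != 0 :> K.
Proof. by rewrite cardsX natrM mulf_neq0. Qed.

(** The product descends to elements compared by marks: one argument is changed at a time, and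
    [gmk0_sum] annihilates the difference. *)
Lemma pmk_beq x x' y y' N : beq G x x' -> beq G y y' -> pmk G x y N = pmk G x' y' N.
Proof.
move=> Ex Ey; apply/eqP; rewrite -subr_eq0.
have -> : pmk G x y N - pmk G x' y' N = pmk G (x - x') y N + pmk G x' (y - y') N.
  by rewrite pmkBl pmkBr addrA subrK.
rewrite addr_eq0; apply/eqP.
have z (v v' : {ffun {group gT * gT} -> K}) : beq G v v' ->
    forall H : {group gT * gT}, H \subset GGg G -> gmk (GGg G) (v - v') H = 0.
  by move=> E H sH; rewrite gmkD gmkN -!bmkE E ?subrr.
transitivity (0 : K).
  rewrite /pmk; under eq_bigr => L _ do under eq_bigr => M _ do rewrite -mulrA.
  under eq_bigr => L _ do rewrite -mulr_sumr.
  apply: (gmk0_sum (G := GGg G) (w := fun L =>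
    \sum_(M : {group gT * gT} | M \subset GGg G) y M * (prodmark G L M N)%:R)) => //.
  - exact: nzGG.
  - exact: z.
  - by move=> L g _ Gg; apply: eq_bigr => M _; rewrite -(prodmarkJ L M N Gg (group1 _)) conjsg1.
apply/esym/eqP; rewrite oppr_eq0; apply/eqP.
rewrite /pmk exchange_big /=.
under eq_bigr => M _ do under eq_bigr => L _ do rewrite [x' L * _]mulrC -mulrA.
under eq_bigr => M _ do rewrite -mulr_sumr.
apply: (gmk0_sum (G := GGg G) (w := fun M =>
  \sum_(L : {group gT * gT} | L \subset GGg G) x' L * (prodmark G L M N)%:R)) => //.
- exact: nzGG.
- exact: z.
- by move=> M g _ Gg; apply: eq_bigr => L _; rewrite -(prodmarkJ L M N (group1 _) Gg) conjsg1.
Qed.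

(* Membership of x in K B^Delta(G,G), up to equality of marks. *)
Definition isB x := exists2 x', bsupp x' & beq G x x'.

Lemma isB_bmk0 x N : isB x -> N \subset GG G -> ~~ bifree G N -> bmk G x N = 0.
Proof. by case=> x' sx' E sN nN; rewrite E // bmk_bifree. Qed.

Lemma pmk_conv x y N : isB x -> isB y -> N \subset GG G ->
  (~~ bifree G N -> pmk G x y N = 0) /\
  (bifree G N -> #|G|%:R * pmk G x y N =
    \sum_(M : {group gT * gT} | bifree G M && (snd @* M == snd @* N))
      bmk G x (relM N (relV M)) * bmk G y M).
Proof.
case=> x' sx Ex [y' sy Ey] sN; rewrite (pmk_beq N Ex Ey); split=> [nN|fN].
  rewrite /pmk big1 // => L _; rewrite big1 // => M _.
  have [/sx fL|/negbNE/eqP->] := boolP (x' L != 0); last by rewrite !mul0r.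
  have [/sy fM|/negbNE/eqP->] := boolP (y' M != 0); last by rewrite mulr0 mul0r.
  have [E _] := prodmark_conv N fL fM.
  by rewrite [prodmark _ _ _ _](_ : _ = 0%N) ?mulr0 //; apply/eqP; apply: contraR nN => /E.
rewrite [RHS](eq_bigr (fun M => bmk G x' (relM N (relV M)) * bmk G y' M)); last first.
  move=> M /andP[fM _]; rewrite Ex; last by apply: (@bifree_sub _ _ (relM_group N (relV_group
    M))); rewrite bifreeM ?bifreeV.
  by rewrite Ey //; apply: bifree_sub.
rewrite /bmk.
under [RHS]eq_bigr => M _ do rewrite big_distrlr /=.
rewrite [RHS]exchange_big /= mulr_sumr; apply: eq_bigr => L _.
rewrite [RHS]exchange_big /= mulr_sumr; apply: eq_bigr => M _.
have [/sx fL|/negbNE/eqP->] := boolP (x' L != 0); last first.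
  by rewrite !mul0r mulr0 big1 // => M' _; rewrite !mul0r.
have [/sy fM|/negbNE/eqP->] := boolP (y' M != 0); last first.
  by rewrite mulr0 mul0r mulr0 big1 // => M' _; rewrite mul0r mulr0.
have [_ /(_ fN) E] := prodmark_conv N fL fM.
rewrite mulrCA -natrM E natr_sum mulr_sumr; apply: eq_bigr => M' _.
by rewrite natrM mulrACA.
Qed.

End Field.
End Convolution.

(** * Elements acting by scalars *)

Section Scalar.
Local Open Scope group_scope.
Local Open Scope ring_scope.
Variables (gT : finGroupType) (G : {group gT}).
Implicit Types (L M N A B : {group gT * gT}) (H U : {group gT}).

Lemma ucountP N : ucount G N != 0%N ->
  exists2 g, g \in G & forall x y, (x, y) \in N -> x = (y ^ g)%g.
Proof.
rewrite cards_eq0 => /set0Pn[g]; rewrite inE => /andP[Gg /forall_inP gN].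
by exists g => // x y /gN/eqP.
Qed.

Lemma fst_inner N g : (forall x y, (x, y) \in N -> x = (y ^ g)%g) -> fst @* N = (snd @* N :^ g)%g.
Proof.
move=> E; apply/setP=> x; apply/mem_p1/imsetP => [[y Ny]|[y /mem_p2[x' Ny] ->]].
  by exists y; [apply/mem_p2; exists x | apply: E].
by exists y; rewrite -(E _ _ Ny).
Qed.

Lemma ucount_bifree N : N \subset GG G -> ucount G N != 0%N -> bifree G N.
Proof.
move=> sN /ucountP[g _ E]; apply/bifreeP; split=> // x Nx; first by rewrite (E _ _ Nx) conj1g.
by have /esym/eqP := E _ _ Nx; rewrite conjg_eq1 => /eqP.
Qed.

Lemma ucountJ N a b : a \in G -> b \in G -> ucount G (N :^ (a, b)) = ucount G N.
Proof.
move=> Ga Gb; rewrite /ucount; symmetry.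
rewrite -(card_imset _ (f := fun g => (b^-1 * g * a)%g)); last first.
  by move=> g h /mulIg/mulgI.
apply: eq_card => h; rewrite inE; apply/imsetP/andP => [[g]|[Gh /forall_inP hN]].
  rewrite inE => /andP[Gg /forall_inP gN] ->; rewrite !groupM ?groupV //; split=> //.
  apply/forall_inP=> -[x y]; rewrite memJ_pair => /gN /=.
  by rewrite -(inj_eq (@conjg_inj _ a)) conjgKV !conjgM.
exists (b * h * a^-1)%g; last by rewrite !mulgA mulVg mul1g mulgKV.
rewrite inE !groupM ?groupV //; apply/forall_inP=> -[x y] Nxy.
have /hN : ((x, y) ^ (a, b))%g \in N :^ (a, b) by rewrite memJ_conjg.
by rewrite pairJ /= -(inj_eq (@conjg_inj _ a^-1%g)) conjgK !conjgM.
Qed.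

Lemma ucount_diag U : ucount G (diag U) = #|'C_G(U)|.
Proof.
apply: eq_card => g; rewrite !inE; congr (_ && _); apply/forall_inP/centP => [E y Uy|cg].
  have := E (y, y); rewrite mem_diag eqxx Uy => /(_ isT)/eqP /=.
  by move=> Ey; rewrite /commute {1}Ey conjgE mulKVg.
move=> [x y]; rewrite mem_diag => /andP[/eqP-> Uy] /=.
by rewrite conjgE -(cg y Uy) mulKg.
Qed.

Lemma snd_sub N : N \subset GG G -> snd @* N \subset G.
Proof.
move=> /subsetP sN; apply/subsetP=> y /mem_p2[x /sN].
by rewrite (@memGG _ G) => /andP[].
Qed.

Lemma fst_sub N : N \subset GG G -> fst @* N \subset G.
Proof.
move=> /subsetP sN; apply/subsetP=> y /mem_p1[x /sN].
by rewrite (@memGG _ G) => /andP[].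
Qed.

Lemma snd_relMV N M : snd @* M = snd @* N -> snd @* (relM N (relV M)) = fst @* M.
Proof.
move=> E; apply/setP=> z; apply/(@mem_p2 _ (relM_group N (relV_group M)))/mem_p1.
  by case=> x /relMP[y _]; rewrite relVE => My; exists y.
case=> y My; have: y \in snd @* N by rewrite -E; apply/mem_p2; exists z.
by case/mem_p2=> x Nx; exists x; apply/relMP; exists y; rewrite ?relVE.
Qed.

Lemma relMV_inner N M g : bifree G N -> snd @* M = snd @* N ->
  [forall n in relM N (relV M), n.1 == (n.2 ^ g)%g] = (M == (N :^ (g^-1%g, 1%g))%G).
Proof.
move=> fN E; apply/forall_inP/eqP => [H|->].
  have in_MN x y z : (x, y) \in N -> (z, y) \in M -> x = (z ^ g)%g.
    by move=> Nx Mz; apply/eqP/(H (x, z))/relMP; exists y; rewrite ?relVE.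
  apply/val_inj/setP=> -[z y]; rewrite [RHS]memJ_pair invgK invg1 conjg1; apply/idP/idP =>
    [Mz|Nz].
    have: y \in snd @* N by rewrite -E; apply/mem_p2; exists z.
    by case/mem_p2=> x Nx; rewrite -(in_MN _ _ _ Nx Mz).
  have: y \in snd @* M by rewrite E; apply/mem_p2; exists (z ^ g)%g.
  by case/mem_p2=> z' Mz'; have /conjg_inj-> := in_MN _ _ _ Nz Mz'.
move=> [x z] /relMP[y Nx]; rewrite relVE memJ_pair invgK invg1 conjg1 => Nz.
by rewrite /= (bifree_inj1 fN Nx Nz).
Qed.

Lemma snd_conj N a b : snd @* (N :^ (a, b)) = (snd @* N :^ b)%g.
Proof.
apply/setP=> y; rewrite mem_conjg; apply/(@mem_p2 _ (N :^ (a, b))%G)/mem_p2 => -[x].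
  by rewrite memJ_pair; eexists; eauto.
by exists (x ^ a)%g; rewrite memJ_pair conjgK.
Qed.

Lemma fst_conj N a b : fst @* (N :^ (a, b)) = (fst @* N :^ a)%g.
Proof.
apply/setP=> y; rewrite mem_conjg; apply/(@mem_p1 _ (N :^ (a, b))%G)/mem_p1 => -[x].
  by rewrite memJ_pair; eexists; eauto.
by exists (x ^ b)%g; rewrite memJ_pair conjgK.
Qed.

Lemma snd_inner N g : (forall x y, (x, y) \in N -> x = (y ^ g)%g) -> N = (diag_group (snd @* N)
  :^ (g, 1%g))%G.
Proof.
move=> E; apply/val_inj/setP=> -[x y]; rewrite [RHS]memJ_pair invg1 conjg1 mem_diag.
apply/idP/andP => [Nx|[/eqP Ex /mem_p2[x' Nx']]].
  by rewrite (E _ _ Nx) conjgK eqxx; split=> //; apply/mem_p2; exists x.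
by rewrite -[x](conjgKV g) Ex -(E _ _ Nx').
Qed.

Variable K : fieldType.
Hypothesis nzG : #|G|%:R != 0 :> K.
Implicit Types (f b : {ffun {group gT * gT} -> K}) (c : {group gT} -> K).

(* f acts on the component of N through the scalar c of its source. *)
Definition scal f c := forall N, N \subset GG G -> bmk G f N = c (snd @* N)%G * (ucount G N)%:R.

Definition cinv c := forall H g, g \in G -> c (H :^ g)%G = c H.

Lemma isB_Dlt (x : {ffun {group gT} -> K}) : isB G (Dlt G x).
Proof. by exists (Dlt G x) => //; apply: bsupp_Dlt. Qed.

Lemma isBD f b : isB G f -> isB G b -> isB G (f + b).
Proof.
case=> f' sf Ef [b' sb Eb]; exists (f' + b') => [L|N sN]; last by rewrite !bmkD Ef ?Eb.
rewrite ffunE; apply: contraNT => nL.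
by rewrite (bsuppN0 sf nL) (bsuppN0 sb nL) addr0.
Qed.

Lemma isBN f : isB G f -> isB G (- f).
Proof.
case=> f' sf Ef; exists (- f') => [L|N sN]; last by rewrite !bmkN Ef.
by rewrite ffunE oppr_eq0 => /sf.
Qed.

(** Only those M count for which N M^-1 is induced by some g in G, so the sum over M becomes a sum
    over G. Each g gives the single M = N^(g^-1, 1), where b has the same mark as at N; the |G|
    equal terms cancel the factor |G|. The target of M is only a conjugate of that of N, which is
    where the invariance of c enters. *)
Lemma conv_l f b c N : isB G f -> isB G b -> scal f c -> cinv c -> N \subset GG G -> bifree G N ->
  pmk G f b N = c (fst @* N)%G * bmk G b N.
Proof.
move=> Bf Bb sf cJ sN fN; apply: (mulfI nzG).
have [_ /(_ fN)->] := pmk_conv nzG Bf Bb sN.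
transitivity (\sum_(M : {group gT * gT} | bifree G M && (snd @* M == snd @* N))
    \sum_(g in G | M == (N :^ (g^-1%g, 1%g))%G) c (fst @* M)%G * bmk G b M).
  apply: eq_bigr => M /andP[fM /eqP E].
  rewrite (sf (relM_group N (relV_group M))); last by apply: bifree_sub; rewrite bifreeM ?bifreeV.
  rewrite sumr_const -[RHS]mulr_natl [LHS]mulrAC [RHS]mulrC; congr (_ * _ * _).
    by congr (c _); apply/val_inj; rewrite /= snd_relMV.
  congr (_%:R); apply: eq_card => g; rewrite !inE; congr (_ && _).
  by rewrite relMV_inner.
rewrite (exchange_big_dep (mem G)) /=; last by move=> M g _ /andP[].
transitivity (\sum_(g in G) c (fst @* N)%G * bmk G b N); last by rewrite sumr_const mulr_natl.
apply: eq_bigr => g Gg; have GG1 : (g^-1, 1)%g \in GGg G by rewrite memGG groupV Gg group1.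
rewrite (big_pred1 (N :^ (g^-1%g, 1%g))%G) => [|M /=].
  rewrite bmkJ //; congr (_ * _); rewrite -(cJ (fst @* N)%G g^-1%g) ?groupV //.
  by congr (c _); apply/val_inj; rewrite /= fst_conj.
rewrite Gg /=; case: (M =P _) => [->|]; last by rewrite andbF.
by rewrite bifreeJ //= snd_conj conjsg1 eqxx.
Qed.

Lemma conv_r f b c N : isB G f -> isB G b -> scal f c -> N \subset GG G -> bifree G N ->
  pmk G b f N = c (snd @* N)%G * bmk G b N.
Proof.
move=> Bf Bb sf sN fN; apply: (mulfI nzG).
have [_ /(_ fN)->] := pmk_conv nzG Bb Bf sN.
(* [D g] is conjugation by g on the source of N; composing N with its inverse merely conjugates N by
   (1, g). *)
pose D g := (diag_group (snd @* N) :^ (g, 1%g))%G.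
transitivity (\sum_(M : {group gT * gT} | bifree G M && (snd @* M == snd @* N))
    \sum_(g in G | M == D g) c (snd @* N)%G * bmk G b (relM N (relV M))).
  apply: eq_bigr => M /andP[fM /eqP E].
  have -> : \sum_(g in G | M == D g) c (snd @* N)%G * bmk G b (relM N (relV M)) =
     (ucount G M)%:R * (c (snd @* N)%G * bmk G b (relM N (relV M))).
    rewrite sumr_const mulr_natl; congr (_ *+ _); apply: eq_card => g; rewrite !inE.
    congr (_ && _); apply/eqP/forall_inP => [-> [x y]|gM].
      by rewrite memJ_pair invg1 conjg1 mem_diag /= => /andP[/eqP <- _]; rewrite conjgKV.
    rewrite /D (_ : (snd @* N)%G = (snd @* M)%G); last by apply/val_inj.
    by apply: snd_inner => x y /gM/eqP.
  rewrite sf; last exact: bifree_sub.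
  rewrite (_ : (snd @* N)%G = (snd @* M)%G); last by apply/val_inj.
  ring.
rewrite (exchange_big_dep (mem G)) /=; last by move=> M g _ /andP[].
transitivity (\sum_(g in G) c (snd @* N)%G * bmk G b N); last by rewrite sumr_const mulr_natl.
apply: eq_bigr => g Gg; rewrite (big_pred1 (D g)) => [|M /=].
  congr (_ * _); have -> : relM N (relV (D g)) = (N :^ (1, g))%g.
    apply/setP=> -[x z]; rewrite [RHS]memJ_pair invg1 conjg1; apply/relMP/idP.
      case=> y Nx; rewrite relVE [_ \in _]memJ_pair invg1 conjg1 mem_diag => /andP[/eqP E _].
      by rewrite E.
    move=> Nx; exists (z ^ g^-1)%g => //; rewrite relVE [_ \in _]memJ_pair invg1 conjg1 mem_diag
      eqxx.
    by apply/mem_p2; exists x.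
  by rewrite bmkJ // memGG group1.
rewrite Gg /=; case: (M =P _) => [->|]; last by rewrite andbF.
rewrite bifreeJ ?memGG ?Gg ?group1 ?diag_bifree ?snd_sub //=.
rewrite (@snd_conj (diag_group _)). by rewrite conjsg1 snd_diag eqxx.
Qed.

Lemma scal_pmk f b c d N : isB G f -> isB G b -> scal f c -> scal b d -> N \subset GG G ->
  pmk G b f N = c (snd @* N)%G * d (snd @* N)%G * (ucount G N)%:R.
Proof.
move=> Bf Bb sf sb sN; have [fN|nN] := boolP (bifree G N).
  by rewrite (conv_r Bf Bb sf) // sb // mulrA.
have [-> // _] := pmk_conv nzG Bb Bf sN.
suff -> : ucount G N = 0%N by rewrite mulr0.
by apply/eqP; apply: contraR nN; apply: ucount_bifree.
Qed.

End Scalar.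

(** * Restriction to automorphism groups *)

(** In a rank factorization M = C B, idempotency forces B C = 1, and C B and B C have the same
    trace. *)
Lemma mxtrace_idem (K : fieldType) n (M : 'M[K]_n) : M *m M = M -> \tr M = (\rank M)%:R.
Proof.
move=> MM; pose C := col_base M; pose B := row_base M.
have CB : C *m B = M by rewrite mulmx_base.
have BC : B *m C = 1%:M.
  apply: (row_full_inj (col_base_full M)); apply: (row_free_inj (row_base_free M)).
  change (C *m (B *m C) *m B = C *m 1%:M *m B).
  have -> : C *m (B *m C) *m B = (C *m B) *m (C *m B) by rewrite !mulmxA.
  by rewrite mulmx1 CB MM.
by rewrite -{1}CB mxtrace_mulC BC mxtrace1.
Qed.

(* Left convolution by alpha is kappa times an idempotent matrix with constant diagonal
   alpha 1 / kappa, so its rank is read off from alpha 1. *)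
Lemma conv_idem_rank (K : fieldType) (aT : finGroupType) (A : {group aT}) (k : K) (alpha : aT ->
  K) :
    k != 0 ->
    (forall s, s \in A -> \sum_(t in A) alpha (t^-1 * s)%g * alpha t = k * alpha s) ->
  exists r : nat, #|A|%:R * alpha 1%g = k * r%:R /\ (r = 0%N -> forall s, s \in A -> alpha s = 0).
Proof.
move=> nzk idem; pose n := #|A|.
pose M := \matrix_(i < n, j < n) (alpha ((enum_val j)^-1 * enum_val i)%g / k).
have MM : M *m M = M.
  apply/matrixP=> i j; rewrite !mxE.
  have Ai := enum_valP i; have Aj := enum_valP j; set s := enum_val i in Ai *;
    set u := enum_val j in Aj *.
  have -> : alpha (u^-1 * s)%g / k = (\sum_(t in A) alpha (t^-1 * (u^-1 * s))%g * alpha t) / k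
    ^+ 2.
    by rewrite idem ?groupM ?groupV // expr2; field.
  rewrite (reindex_inj (mulgI u^-1)%g) /= mulr_suml.
  rewrite (eq_bigl [in A]) => [|l]; last by rewrite groupMl ?groupV.
  rewrite [RHS]big_enum_val /=; apply: eq_bigr => l _;
    rewrite !mxE -/s -/u invMg invgK mulgA mulgK.
  by rewrite expr2; field.
exists (\rank M); split.
  rewrite -mxtrace_idem // /mxtrace (eq_bigr (fun=> alpha 1%g / k)) => [|i _];
    last by rewrite mxE mulVg.
  by rewrite sumr_const card_ord -[_ *+ n]mulr_natl -/n; field.
move/eqP; rewrite mxrank_eq0 => /eqP M0 s As.
have /matrixP/(_ (enum_rank_in As s) (enum_rank_in As 1%g)) := M0.
rewrite !mxE !enum_rankK_in // invg1 mul1g => /eqP; rewrite mulf_eq0 invr_eq0 (negbTE nzk) orbF.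
by move/eqP.
Qed.

Section AutGraph.
Local Open Scope group_scope.
Local Open Scope ring_scope.
Variables (gT : finGroupType) (G U : {group gT}).
Hypothesis sUG : U \subset G.
Implicit Types (M N : {group gT * gT}) (s t : {perm gT}).

Definition graph s : {set gT * gT} := [set (s u, u) | u in U].

Lemma mem_graph s x y : ((x, y) \in graph s) = (x == s y) && (y \in U).
Proof.
apply/imsetP/andP => [[u Uu [-> ->]]|[/eqP-> Uy]]; first by rewrite eqxx.
by exists y.
Qed.

Lemma graph_group_set s : s \in Aut U -> group_set (graph s).
Proof.
move=> As; apply/group_setP; split=> [|[a b] [c d]].
  by rewrite mem_graph group1 andbT -(autmE As) morph1.
rewrite !mem_graph => /andP[/eqP-> Ub] /andP[/eqP-> Ud]; rewrite /= groupM // andbT.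
by rewrite -!(autmE As) morphM.
Qed.

Definition graph_group s (As : s \in Aut U) := Group (graph_group_set As).

Lemma mem_graphG s (As : s \in Aut U) x y : ((x, y) \in graph_group As) = (x == s y) && (y \in U).
Proof. exact: mem_graph. Qed.

Lemma snd_graph s (As : s \in Aut U) : snd @* graph_group As = U.
Proof.
apply/setP=> y; apply/mem_p2/idP => [[x]|Uy]; rewrite ?mem_graphG; first by case/andP.
by exists (s y); rewrite mem_graphG eqxx.
Qed.

Lemma fst_graph s (As : s \in Aut U) : fst @* graph_group As = U.
Proof.
apply/setP=> y; apply/mem_p1/idP => [[x]|Uy].
  by rewrite mem_graphG => /andP[/eqP-> Ux]; rewrite Aut_closed.
exists (s^-1%g y); rewrite mem_graphG permKV eqxx /=.
by rewrite Aut_closed ?groupV.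
Qed.

Lemma graph_bifree s (As : s \in Aut U) : bifree G (graph_group As).
Proof.
apply/bifreeP; split.
- apply/subsetP=> -[x y]; rewrite mem_graphG memGG => /andP[/eqP-> Uy].
  by rewrite !(subsetP sUG) ?Aut_closed.
- by move=> x; rewrite mem_graphG => /andP[/eqP-> _]; rewrite -(autmE As) morph1.
- move=> x; rewrite mem_graphG => /andP[/eqP E Ux]; apply/eqP.
  by rewrite -(morph_injm_eq1 (injm_autm As)) //= autmE -E.
Qed.

Lemma graphM s t : s \in Aut U -> t \in Aut U ->
  relM (graph s) (relV (graph t)) = graph (t^-1 * s)%g.
Proof.
move=> As At; apply/setP=> -[x z]; rewrite mem_graph permM; apply/relMP/andP.
  case=> y; rewrite relVE !mem_graph => /andP[/eqP-> Uy] /andP[/eqP-> _].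
  by rewrite permK eqxx Aut_closed.
case=> /eqP-> Uz; exists (t^-1%g z); rewrite ?relVE mem_graph ?permKV eqxx /=.
  by rewrite Aut_closed ?groupV.
by rewrite Aut_closed ?groupV.
Qed.

Lemma graph1 : graph 1%g = diag U.
Proof. by apply: eq_imset => u; rewrite perm1. Qed.

Lemma graph_inj s t : s \in Aut U -> t \in Aut U -> graph s = graph t -> s = t.
Proof.
move=> As At E; apply: (eq_Aut As At) => u Uu.
have: (s u, u) \in graph t by rewrite -E mem_graph eqxx.
by rewrite mem_graph => /andP[/eqP].
Qed.

Lemma bifree_graph M : bifree G M -> fst @* M = U -> snd @* M = U ->
  exists2 s, s \in Aut U & M = graph s :> {set gT * gT}.
Proof.
move=> fM E1 E2; pose f y := odflt 1%g [pick x | (x, y) \in M].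
have fP y : y \in U -> (f y, y) \in M.
  rewrite -E2 => /mem_p2[x Mx]; rewrite /f; case: pickP => //= /(_ x).
  by rewrite Mx.
have fE x y : (x, y) \in M -> x = f y.
  move=> Mx; apply: (bifree_inj1 fM Mx); apply: fP; rewrite -E2; apply/mem_p2.
  by exists x.
have fmorph : {in U &, {morph f : x y / (x * y)%g}}.
  by move=> x y Ux Uy; apply/esym/fE; rewrite -pairM groupM ?fP.
pose fm := Morphism fmorph.
have finj : 'injm fm.
  apply/injmP=> x y Ux Uy /= E; apply: (bifree_inj2 fM (fP x Ux)).
  by rewrite E fP.
have fim : fm @* U = U.
  apply/setP=> x; apply/morphimP/idP => [[y _ Uy ->]|].
    by rewrite /= -[in X in _ \in X]E1; apply/mem_p1; exists y; apply: fP.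
  rewrite -{1}E1 => /mem_p1[y Mx]; have Uy : y \in U by rewrite -E2; apply/mem_p2; exists x.
  by exists y => //=; apply: fE.
exists (aut finj fim); first exact: Aut_aut.
apply/setP=> -[x y]; rewrite mem_graph; apply/idP/andP => [Mx|[/eqP-> Uy]].
  have Uy : y \in U by rewrite -E2; apply/mem_p2; exists x.
  by rewrite Uy autE //= -(fE _ _ Mx).
by rewrite autE //= fP.
Qed.

Variable K : fieldType.
Hypothesis nzG : #|G|%:R != 0 :> K.


Lemma card_conj_to (V : {set gT}) h : h \in G -> V = U :^ h ->
  #|[set g in G | V == U :^ g]| = #|'N_G(U)|.
Proof.
move=> Gh ->; rewrite -[RHS](card_imset _ (mulIg h)); apply: eq_card => g; rewrite inE.
apply/andP/imsetP => [[Gg /eqP E]|[k]].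
  exists (g * h^-1)%g; last by rewrite mulgKV.
  by rewrite inE groupM ?groupV //=; apply/normP; rewrite conjsgM -E conjsgK.
by rewrite inE => /andP[Gk /normP nk] ->; rewrite groupM // conjsgM nk.
Qed.

(* Every M with source U and target conjugate to U is a conjugation after an automorphism
   of U, in exactly |N_G(U)| ways. *)
Lemma sum_graph (F : {set gT * gT} -> K) :
    (forall M g, g \in G -> F (M :^ (g, 1%g))%g = F M) ->
    (forall M, bifree G M -> snd @* M = U -> ~~ conjG G (fst @* M) U -> F M = 0) ->
  #|'N_G(U)|%:R * \sum_(M : {group gT * gT} | bifree G M && (snd @* M == U)) F M =
  #|G|%:R * \sum_(s in Aut U) F (graph s).
Proof.
move=> FJ F0.
have -> : #|G|%:R * \sum_(s in Aut U) F (graph s) =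
    \sum_(p in setX (Aut U) G) F (graph p.1 :^ (p.2, 1%g))%g.
  rewrite (eq_bigl (fun p : {perm gT} * gT => (p.1 \in Aut U) && (p.2 \in G))); last first.
    by case=> s g; rewrite inE.
  rewrite -(pair_big (mem (Aut U)) (mem G) (fun s g => F (graph s :^ (g, 1%g))%g)) /=.
  rewrite mulr_sumr; apply: eq_bigr => s As.
  rewrite (eq_bigr (fun=> F (graph s))) ?sumr_const ?mulr_natl // => g Gg.
  exact: (FJ (graph_group As)).
(* Taking the generated subgroup makes [gr] total in the permutation; the graph of an automorphism
   is already a group. *)
pose gr (p : {perm gT} * gT) : {group gT * gT} := (<<graph p.1>> :^ (p.2, 1%g))%G.
have grE s g (As : s \in Aut U) : gr (s, g) = (graph_group As :^ (g, 1%g))%G.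
  by apply/val_inj; rewrite /= (genGid (graph_group As)).
clearbody gr.
rewrite (partition_big gr (fun M => bifree G M && (snd @* M == U))) /=; last first.
  case=> s g; rewrite in_setX => /andP[As Gg]; rewrite (grE _ _ As).
  by rewrite bifreeJ ?graph_bifree ?memGG ?Gg ?group1 //= (snd_conj (graph_group As)) snd_graph
    conjsg1 eqxx.
rewrite mulr_sumr; apply: eq_bigr => M /andP[fM /eqP EM].
rewrite (eq_bigr (fun=> F M)) => [|[s g] /andP[]]; last first.
  by rewrite in_setX => /andP[As Gg]; rewrite (grE _ _ As) => /eqP<-.
have [cM|nc] := boolP (conjG G (fst @* M) U); last by rewrite F0 // mulr0 big1.
rewrite sumr_const mulr_natl; congr (_ *+ _).
have {cM} [h Gh Eh] : exists2 h, h \in G & fst @* M = (U :^ h)%g.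
  case/exists_inP: cM => h Gh /eqP E; by exists h.
have DE s g : ((s, g) \in (fun i => (i \in setX (Aut U) G) && (gr i == M))) =
    [&& s \in Aut U, g \in G & gr (s, g) == M].
  by rewrite [LHS]unfold_in in_setX -andbA.
rewrite -(card_conj_to Gh Eh) -(card_in_imset (f := snd)); last first.
  case=> [s g] [s' g']; rewrite !DE => /and3P[As Gg /eqP E] /and3P[As' Gg' /eqP E'] /= eg.
  move: E'; rewrite -eg -E (grE _ _ As) (grE _ _ As') =>
    /(congr1 val)/conjsg_inj/(graph_inj As' As)->.
  by [].
apply: eq_card => g; rewrite inE; apply/andP/imsetP => [[Gg /eqP E]|[[s g']]].
  have GGg1 : (g^-1%g, 1%g) \in GGg G by rewrite memGG groupV Gg group1.
  have [||s As Es] := @bifree_graph (M :^ (g^-1%g, 1%g))%G (bifreeJ GGg1 fM).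
  - by rewrite /= fst_conj E conjsgK.
  - by rewrite /= snd_conj EM conjsg1.
  exists (s, g) => //; rewrite DE As Gg (grE _ _ As) -val_eqE /= -Es.
  by rewrite -conjsgM pairM mulVg mulg1 conjsg1.
rewrite DE => /and3P[As Gg /eqP <-] ->; split=> //=.
by rewrite (grE _ _ As) /= (fst_conj (graph_group As)) fst_graph.
Qed.

(** The square of f at [graph s] sums over all M with source U. Those whose target is not conjugate
    to U drop out, and [sum_graph] folds the rest onto Aut(U), replacing the factor |G| by
    |N_G(U)|. *)
Lemma idem_graph (f : {ffun {group gT * gT} -> K}) : isB G f -> bidem G f ->
    (forall M, bifree G M -> ~~ conjG G (fst @* M) (snd @* M) -> bmk G f M = 0) ->
  forall s, s \in Aut U ->
  \sum_(t in Aut U) bmk G f (graph (t^-1 * s)%g) * bmk G f (graph t) =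
  #|'N_G(U)|%:R * bmk G f (graph s).
Proof.
move=> Bf If f0 s As; pose N := graph_group As.
have fN : bifree G N := graph_bifree As.
pose F (M : {set gT * gT}) := bmk G f (relM N (relV M)) * bmk G f M.
have FJ (M : {group gT * gT}) g : g \in G -> F (M :^ (g, 1%g))%g = F M.
  move=> Gg; have Gg1 : (g, 1%g) \in GGg G by rewrite memGG Gg group1.
  have G1g : (1%g, g) \in GGg G by rewrite memGG Gg group1.
  rewrite /F [bmk G f (M :^ _)]bmkJ //; congr (_ * _).
  rewrite -[RHS](@bmkJ _ G _ f (relM N (relV M)) (1%g, g)) //; congr bmk.
  apply/setP=> -[x z]; rewrite (@memJ_pair _ (relM_group N (relV_group M))) invg1 conjg1.
  apply/relMP/relMP => -[y Nx]; rewrite relVE.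
    by rewrite memJ_pair invg1 conjg1; exists y; rewrite ?relVE.
  by exists y; rewrite ?relVE // memJ_pair invg1 conjg1.
have F0 (M : {group gT * gT}) : bifree G M -> snd @* M = U -> ~~ conjG G (fst @* M) U -> F M = 0.
  by move=> fM EM nc; rewrite /F f0 ?mulr0 // EM.
have := sum_graph FJ F0.
have [_ /(_ fN)] := pmk_conv nzG Bf Bf (bifree_sub fN).
rewrite snd_graph If ?bifree_sub // => <-; rewrite mulrCA => /(mulfI nzG) ->.
by apply: eq_bigr => t At; rewrite /F graphM.
Qed.

End AutGraph.

(** * Integrality and congruences over R *)

Lemma nat_multiple_extreme (R : idomainType) (n r s : nat) (c : R) :
    (1 < n)%N ->
    (forall p, prime p -> (p %| n)%N -> (p%:R : R) != 0 /\ ~~ ((p%:R : R) \is a GRing.unit)) ->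
    r%:R = n%:R * c -> s%:R = n%:R * (1 - c) -> r = 0%N \/ s = 0%N.
Proof.
move=> n_gt1 Hp Er Es.
have nu p m k : prime p -> (p %| n)%N -> (p%:R * m = k%:R :> R) -> coprime k p -> False.
  move=> pr_p dvp E co; have [_ /negP] := Hp p pr_p dvp; apply.
  have k_gt0 : (0 < k)%N by case: k co {E} => //; rewrite /coprime gcd0n => /eqP p1;
    rewrite p1 in pr_p.
  have [a b E1 _] := egcdnP p k_gt0; rewrite (eqP co) in E1.
  apply/unitrPr; exists (a%:R * m - b%:R); rewrite mulrBr mulrCA E -!natrM E1 natrD.
  by rewrite [(p * b)%N]mulnC addrC addKr.
(* In positive characteristic q a prime p dividing n would be nonzero, hence different from q, and p
   * 0 = q would make it invertible. *)
have char0 m : (0 < m)%N -> (m%:R : R) != 0.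
  move=> m_gt0; apply/negP => /(natf0_pchar m_gt0)[q]; rewrite inE => /andP[pr_q /eqP q0].
  have pr_p := pdiv_prime n_gt1; have dvp := pdiv_dvd n.
  have [nzp _] := Hp _ pr_p dvp.
  apply: (@nu _ 0 q pr_p dvp); first by rewrite mulr0 q0.
  rewrite prime_coprime // dvdn_prime2 //; apply: contraNneq nzp => <-.
  by rewrite q0.
have nat_lt a b : (a < b)%N -> a%:R <> b%:R :> R.
  move=> lt E; have gt0 : (0 < b - a)%N by rewrite subn_gt0.
  by have /eqP := char0 _ gt0; apply; rewrite (natrB _ (ltnW lt)) E subrr.
have natI a b : a%:R = b%:R :> R -> a = b.
  by move=> E; case: (ltngtP a b) => // /nat_lt; rewrite E.
have rsn : (r + s)%N = n by apply: natI; rewrite natrD Er Es; ring.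
(* With r/n in lowest terms, a prime dividing the denominator n' would be invertible in R. So n
   divides r, and r + s = n leaves only r = 0 and r = n. *)
pose d := gcdn r n; have d_gt0 : (0 < d)%N by rewrite gcdn_gt0 orbC ltnW.
have /dvdnP[r' r'd] := dvdn_gcdl r n; have /dvdnP[n' n'd] := dvdn_gcdr r n;
  rewrite -/d in r'd n'd.
have E' : n'%:R * c = r'%:R.
  by apply: (mulIf (char0 _ d_gt0)); rewrite mulrAC -!natrM -n'd -r'd Er.
have co : coprime r' n'.
  by rewrite /coprime -(eqn_pmul2r d_gt0) muln_gcdl mul1n -r'd -n'd.
have [le1|lt1] := leqP n' 1; last first.
  exfalso; have pr_p := pdiv_prime lt1; have /dvdnP[k Ek] := pdiv_dvd n'.
  apply: (@nu _ (k%:R * c) r' pr_p).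
  - by rewrite n'd; apply: dvdn_mulr; apply: pdiv_dvd.
  - by rewrite mulrA -natrM mulnC -Ek.
  - by apply: coprime_dvdr co; apply: pdiv_dvd.
have n1 : n' = 1%N by apply/eqP; rewrite eqn_leq le1; case: n' n'd {E' co le1} => // n0;
  rewrite n0 in n_gt1.
move: n'd r'd; rewrite n1 mul1n => <- Er'.
case: r' Er' {co E'} => [|[|r']] Er'; [by left | right | ].
  by move: rsn; rewrite Er' mul1n -{2}[n]addn0 => /addnI.
have: (n < r + s)%N.
  by rewrite Er' !mulSn -!addnA -{1}[n]addn0 ltn_add2l addn_gt0 (ltnW n_gt1).
by rewrite rsn ltnn.
Qed.

Section Fraction.
Local Open Scope group_scope.
Local Open Scope ring_scope.
Variables (gT : finGroupType) (G : {group gT}) (R : idomainType).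
Local Notation K := {fraction R}.
Hypothesis nzGR : #|G|%:R != 0 :> R.
Implicit Types (f : {ffun {group gT * gT} -> K}) (M : {group gT * gT}) (H U N : {group gT}).

Lemma nzGK : #|G|%:R != 0 :> K.
Proof. by rewrite -(rmorph_nat (@tofrac R)) tofrac_eq0. Qed.

Definition fr (I : finType) (r : {ffun I -> R}) : {ffun I -> K} := [ffun i => tofrac (r i)].

Lemma gmk_fr (rT : finGroupType) (A : {group rT}) (r : {ffun {group rT} -> R}) (H : {set rT}) :
  gmk A (fr r) H = tofrac (gmk A r H).
Proof.
rewrite /gmk rmorph_sum; apply: eq_bigr => U _.
by rewrite ffunE rmorphM rmorph_nat.
Qed.

Lemma bmk_fr (r : {ffun {group gT * gT} -> R}) (M : {set gT * gT}) : bmk G (fr r) M = tofrac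
  (bmk G r M).
Proof. by rewrite !bmkE gmk_fr. Qed.

Lemma inRBD_fr (r : {ffun {group gT * gT} -> R}) : bsupp G r -> inRBD G (fr r).
Proof. by move=> sr; exists r; split. Qed.

Lemma inRBD_isB f : inRBD G f -> isB G f.
Proof. by case=> r [sr E]; exists (fr r) => // L; rewrite ffunE tofrac_eq0 => /sr. Qed.

Lemma inRBD_B f f' : inRBD G f -> inRBD G f' -> inRBD G (f - f').
Proof.
case=> r [sr E] [r' [sr' E']]; exists (r - r'); split=> [L|N sN].
  rewrite !ffunE; apply: contraNT => nL.
  by rewrite (bsuppN0 sr nL) (bsuppN0 sr' nL) subr0.
rewrite bmkD bmkN E // E' // -!/(fr _) !bmk_fr.
by rewrite bmkD bmkN rmorphB.
Qed.

(* The subgroup (C_G(N) x 1) Delta(U) of G x G, acting on the Delta(N)-fixed points. *)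
Definition gam (N U : {set gT}) : {set gT * gT} := [set (p.1 * p.2, p.2)%g | p in setX 'C_G(N) U].

Lemma mem_gam N U x u : ((x, u) \in gam N U) = (x * u^-1 \in 'C_G(N))%g && (u \in U).
Proof.
apply/imsetP/andP => [[[t v]]|[Cx Uu]].
  by rewrite in_setX => /andP[Ct Uv] [-> ->]; rewrite mulgK.
by exists (x * u^-1, u)%g; rewrite ?in_setX ?Cx //= mulgKV.
Qed.

Lemma norm_cent N U u : N <| U -> U \subset G -> u \in U -> u \in 'N('C_G(N)).
Proof.
move=> /andP[_ nNU] sUG; apply/subsetP.
by apply: normsI; [apply: subset_trans (normG G) | apply: subset_trans (cent_norm N)].
Qed.

Lemma gam_group_set N U : N <| U -> U \subset G -> group_set (gam N U).
Proof.
move=> nNU sUG; apply/group_setP; split=> [|[x u] [y v]].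
  by rewrite (mem_gam N U 1%g 1%g) mulgV !group1.
rewrite !mem_gam => /andP[Cx Uu] /andP[Cy Uv]; rewrite /= [X in _ && X]groupM // andbT.
rewrite invMg -mulgA [(y * _)%g]mulgA; have -> : (x * (y * v^-1 * u^-1) = (x * u^-1) * (y *
  v^-1) ^ u^-1)%g.
  by rewrite conjgE invgK !mulgA mulgKV.
by rewrite groupM // memJ_norm // groupV (norm_cent nNU).
Qed.

Lemma gam_sum N U (F : gT * gT -> K) :
  \sum_(n in gam N U) F n = \sum_(u in U) \sum_(t in 'C_G(N)) F (t * u, u)%g.
Proof.
rewrite big_imset /=; last by move=> [t u] [t' u'] _ _ /= [+ E]; rewrite E => /mulIg->.
rewrite (eq_bigl (fun p : gT * gT => (p.1 \in 'C_G(N)) && (p.2 \in U))); last by case=> a b;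
  rewrite in_setX.
by rewrite -(pair_big [in 'C_G(N)] [in U] (fun t u => F (t * u, u)%g)) exchange_big.
Qed.

Lemma card_gam N U : #|gam N U| = (#|'C_G(N)| * #|U|)%N.
Proof.
by rewrite card_imset ?cardsX // => -[a b] [c d] [+ E]; rewrite /= E => /mulIg->.
Qed.

Lemma burnside_gam f N U : inRBD G f -> N <| U -> U \subset G ->
  exists rho : R, \sum_(u in U) \sum_(t in 'C_G(N)) bmk G f (diag N <*> <[(t * u, u)%g]>)%g =
    (#|'C_G(N)| * #|U|)%:R * tofrac rho.
Proof.
move=> [r [sr E]] nNU sUG; pose P := Group (gam_group_set nNU sUG).
have nP : diag_group N <| P.
  have [sNU nNU'] := andP nNU; rewrite /normal; apply/andP; split.
    apply/subsetP=> -[x y]; rewrite [_ \in _]mem_diag [_ \in P]mem_gam => /andP[/eqP-> Ny].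
    by rewrite mulgV group1 (subsetP sNU).
  apply/subsetP=> -[x u]; rewrite [_ \in P]mem_gam => /andP[/setIP[_ Cx] Uu].
  rewrite inE; apply/subsetP=> -[a b]; rewrite memJ_pair mem_diag => /andP[/eqP Eab Nb].
  have Nb' : b \in N by rewrite -(memJ_norm b (_ : u^-1%g \in 'N(N))) ?groupV ?(subsetP nNU').
  rewrite [_ \in _]mem_diag Nb' andbT; apply/eqP.
  have: ((a ^ x^-1) ^ (x * u^-1) = b ^ u^-1)%g by rewrite Eab conjgE -(centP Cx _ Nb) mulKg.
  by rewrite conjgM conjgKV => /conjg_inj.
have sP : P \subset GGg G.
  apply/subsetP=> -[x u]; rewrite [_ \in P]mem_gam memGG => /andP[/setIP[Gx _] Uu].
  have Gu := subsetP sUG u Uu; rewrite Gu andbT.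
  by rewrite -(mulgKV u x) groupM.
have [rho Erho] := gmk_burnside r nP sP; exists rho.
rewrite -(gam_sum N U (fun n => bmk G f (diag N <*> <[n]>)%g)) -card_gam mulrC -(rmorph_nat
  (@tofrac R)) -rmorphM -Erho rmorph_sum.
apply: eq_bigr => n Pn; rewrite (E (diag_group N <*> <[n]>)%G); first by rewrite -/(fr r) bmk_fr.
by rewrite join_subG (subset_trans (normal_sub nP)) ?cycle_subG ?(subsetP sP).
Qed.

(** For N = U the term of (t u, u) with t <> 1 vanishes: the subgroup it generates with Delta(U)
    contains (t, 1) and is not bifree. Each u in U thus contributes the mark at Delta(U) once, while
    the count is divisible by |C_G(U)| |U|. *)
Lemma mark_integral f U : inRBD G f -> U \subset G ->
  exists rho : R, bmk G f (diag U) = #|'C_G(U)|%:R * tofrac rho.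
Proof.
move=> Rf sUG; have [rho E] := burnside_gam Rf (normal_refl U) sUG; exists rho.
have nzU : #|U|%:R != 0 :> K := subG_nz nzGK sUG.
apply: (mulfI nzU); rewrite mulrA -natrM mulnC -E mulr_natl -sumr_const; apply: eq_bigr => u Uu.
rewrite (bigD1 1%g) ?group1 //= mul1g big1 ?addr0 => [|t /andP[Ct nt]].
  congr bmk; apply/esym/joing_idPl; rewrite cycle_subG mem_diag eqxx Uu.
  by [].
pose L := (diag_group U <*> <[(t * u, u)%g]>)%G.
have sL : L \subset GGg G.
  rewrite join_subG (bifree_sub (diag_bifree sUG)) cycle_subG memGG (subsetP sUG u Uu) groupM //.
    by case/setIP: Ct.
  exact: (subsetP sUG).
apply: (@isB_bmk0 _ _ _ f L) => //; first exact: inRBD_isB.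
apply: contra nt => /bifreeP[_ E1 _]; apply/eqP/E1.
have Lu : (u, u) \in L by apply: (subsetP (joing_subl _ _)); rewrite mem_diag eqxx.
have Lt : (t * u, u)%g \in L by apply: (subsetP (joing_subr _ _)); apply: cycle_id.
by have := groupM Lt (groupVr Lu); rewrite pairV pairM mulgK mulgV.
Qed.

(** At Delta(N)<(t u, u)> the number [ucount] counts the g in C_G(N) with t u = u^g. Each g
    determines t, so summing over t gives |C_G(N)| times c(N<u>), and this factor cancels. *)
Lemma scal_burnside f c N U : inRBD G f -> scal G f c -> N <| U -> U \subset G ->
  exists rho : R, \sum_(u in U) c (N <*> <[u]>)%G = #|U|%:R * tofrac rho.
Proof.
move=> Rf sf nNU sUG; have [rho E] := burnside_gam Rf nNU sUG; exists rho.
have nzC : #|'C_G(N)|%:R != 0 :> K := subG_nz nzGK (subsetIl G 'C(N)).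
apply: (mulfI nzC); rewrite mulrA -natrM -E mulr_sumr; apply: eq_bigr => u Uu.
have [sNU nNU'] := andP nNU.
have Gu := subsetP sUG u Uu.
transitivity (\sum_(t in 'C_G(N)) \sum_(g in 'C_G(N) | t == (u ^ g * u^-1)%g) c (N <*> <[u]>)%G).
  rewrite (exchange_big_dep [in 'C_G(N)]) /=; last by move=> t g _ /andP[].
  rewrite mulr_natl -sumr_const; apply: eq_bigr => g Cg;
    rewrite (big_pred1 (u ^ g * u^-1)%g) // => t /=.
  rewrite Cg /= andb_idl // => /eqP->.
  have -> : (u ^ g * u^-1 = g^-1 * g ^ u^-1)%g by rewrite !conjgE invgK !mulgA.
  by rewrite groupM ?groupV // memJ_norm // groupV (norm_cent nNU).
apply: eq_bigr => t Ct; pose L := (diag_group N <*> <[(t * u, u)%g]>)%G.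
rewrite -[(diag N <*> _)%g]/(L : {set _}) sf; last first.
  rewrite join_subG (bifree_sub (diag_bifree (subset_trans sNU sUG))) cycle_subG.
  by rewrite (memGG G) Gu groupM //; case/setIP: Ct.
rewrite sumr_const -[LHS]mulr_natr; congr (_ * _).
  congr (c _); apply/val_inj; rewrite /= morphimY ?subsetT // (snd_diag N) morphim_cycle
    ?in_setT //.
congr (_%:R); apply: eq_card => g; rewrite [LHS]unfold_in in_setI [RHS]inE -andbA; congr (_ && _).
pose D := (diag_group [set: gT] :^ (g, 1%g))%G.
have memD x y : ((x, y) \in D) = (x == (y ^ g)%g).
  by rewrite [LHS]memJ_pair mem_diag in_setT invg1 conjg1 andbT -(inj_eq (@conjg_inj _ g))
    conjgKV.
have -> : [forall n in L, n.1 == (n.2 ^ g)%g] = (L \subset D).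
  apply/forall_inP/subsetP => [H [x y] /H|H [x y] /H]; by rewrite memD.
rewrite join_subG cycle_subG memD; congr (_ && _); last first.
  by rewrite -[LHS](inj_eq (mulIg u)) mulgKV.
apply/centP/subsetP => [Cg [x y]|H y Ny].
  by rewrite [_ \in _]mem_diag memD => /andP[/eqP-> Ny]; rewrite conjgE -(Cg y Ny) mulKg.
have: (y, y) \in D by apply: H; rewrite [_ \in _]mem_diag eqxx.
by rewrite memD => /eqP Ey; rewrite /commute {1}Ey conjgE mulKVg.
Qed.

Lemma scal_int f c U : inRBD G f -> scal G f c -> U \subset G -> exists rho : R, c U = tofrac rho.
Proof.
move=> Rf sf sUG; have [rho E] := scal_burnside Rf sf (normal_refl U) sUG; exists rho.
apply: (mulfI (subG_nz nzGK sUG)); rewrite -E mulr_natl -sumr_const; apply: eq_bigr => u Uu.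
by congr (c _); apply/esym/val_inj/joing_idPl; rewrite cycle_subG.
Qed.

(* For prime index p this says c N = c U modulo p. *)
Lemma scal_congr f c N U : inRBD G f -> scal G f c -> N <| U -> U \subset G -> prime #|U / N|%g ->
  exists rho : R, c N - c U = #|U / N|%g%:R * tofrac rho.
Proof.
move=> Rf sf nNU sUG pr_p; have [rho E] := scal_burnside Rf sf nNU sUG.
have [sNU nNU'] := andP nNU.
have nzN : #|N|%:R != 0 :> K := subG_nz nzGK (subset_trans sNU sUG).
have cUN : (#|U| = #|N| * #|U / N|%g)%N by rewrite card_quotient // Lagrange.
rewrite (bigID [in N]) /= in E.
have E1 : \sum_(u in U | u \in N) c (N <*> <[u]>)%G = #|N|%:R * c N.
  rewrite (eq_bigl [in N]) => [|u]; last by rewrite andb_idl // => /(subsetP sNU).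
  rewrite mulr_natl -sumr_const; apply: eq_bigr => u Nu; congr (c _); apply/val_inj/joing_idPl.
  by rewrite cycle_subG.
have E2 : \sum_(u in U | u \notin N) c (N <*> <[u]>)%G = (#|U|%:R - #|N|%:R) * c U.
  rewrite -natrB ?subset_leq_card // -cardsDS // mulr_natl -sumr_const.
  apply: eq_big => [u|u /andP[Uu nNu]]; first by rewrite inE andbC.
  have sub : (N <*> <[u]> \subset U)%g by rewrite join_subG sNU cycle_subG.
  congr (c _); apply/val_inj/eqP; rewrite eqEsubset sub /=.
  have [sN nN] := (joing_subl N <[u]>, subset_trans sub nNU').
  have dv : (#|(N <*> <[u]>) / N|%g %| #|U / N|%g)%N by rewrite cardSg ?quotientS.
  case/primeP: pr_p => _ /(_ _ dv)/orP[|/eqP Ec].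
    rewrite card_quotient // -indexgI (setIidPr sN) => /eqP/index1g.
    move/(_ sN) => EN; case/negP: nNu; rewrite EN.
    by rewrite -cycle_subG joing_subr.
  have: (U / N \subset (N <*> <[u]>) / N)%g.
    by rewrite (_ : U / N = (N <*> <[u]>) / N)%g //; apply/esym/eqP;
      rewrite eqEcard quotientS // Ec leqnn.
  by rewrite quotientSGK // (subset_trans sNU).
(* After division by |N| the count reads c(N) + (p - 1) c(U) = p rho with p = |U : N|; the term p
   c(U) moves to the right because c(U) itself lies in R. *)
have [rho' E'] := scal_int Rf sf sUG; exists (rho - rho'); rewrite E1 E2 cUN natrM in E.
apply: (mulfI nzN); rewrite tofracB -E' !mulrBr [X in _ = X - _]mulrA -E; ring.
Qed.
End Fraction.

(** * Central idempotents *)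

Section OuterIndex.
Local Open Scope group_scope.
Variables (gT : finGroupType) (G U : {group gT}).

Lemma Inn_norm : Aut U \subset 'N(conj_aut U @* U).
Proof.
apply/subsetP=> s As; rewrite inE; apply/subsetP=> _ /imsetP[_ /morphimP[x Nx Ux ->] ->].
have Usx : s x \in U by rewrite Aut_closed.
suff -> : conj_aut U x ^ s = conj_aut U (s x) by rewrite mem_morphim // (subsetP (normG U)).
have Ac y : y \in 'N(U) -> conj_aut U y \in Aut U by move=> Ny; apply: Aut_aut.
have As1 : conj_aut U x ^ s \in Aut U by rewrite groupJ ?Ac.
have As2 : conj_aut U (s x) \in Aut U by rewrite Ac // (subsetP (normG U)).
apply: (eq_Aut As1 As2) => y Uy; rewrite conjgE !permM.
have Us : s^-1 y \in U by rewrite Aut_closed ?groupV.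
have sJ a b : a \in U -> b \in U -> s (a ^ b) = s a ^ s b.
  by move=> Ua Ub; rewrite -!(autmE As) morphJ.
by rewrite norm_conj_autE // sJ // permKV norm_conj_autE // (subsetP (normG U)).
Qed.

Definition outG := #|Aut U : conj_aut U @* 'N_G(U)|.


Lemma outG_dvd : U \subset G -> (outG %| #|Out U|)%N.
Proof.
move=> sUG; rewrite /Out card_quotient ?Inn_norm //.
rewrite /outG -(@Lagrange_index _ (Aut U) (conj_aut U @* 'N_G(U)) (conj_aut U @* U)) ?dvdn_mulr
  //.
- exact: Aut_conj_aut.
- by rewrite morphimS // subsetI sUG normG.
Qed.

Lemma card_norm : #|'N_G(U)| = (#|'C_G(U)| * #|conj_aut U @* 'N_G(U)|)%N.
Proof.
rewrite card_morphim ker_conj_aut (setIidPr (subsetIr G 'N(U))).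
have E : 'C_G(U) = 'N_G(U) :&: 'C(U) by rewrite -setIA (setIidPr (cent_sub U)).
have := indexgI 'N_G(U) 'C(U); rewrite -E => <-; by rewrite Lagrange // setIS // cent_sub.
Qed.

(** N_G(U)/C_G(U) is the group of automorphisms induced by G. This identity turns the trace
    equation, with mark |C_G(U)| rho at Delta(U), into r = [outG] rho. *)
Lemma card_outG : (#|Aut U| * #|'C_G(U)| = outG * #|'N_G(U)|)%N.
Proof.
rewrite card_norm -(Lagrange (Aut_conj_aut U 'N_G(U))) -/outG.
by rewrite [RHS]mulnCA [RHS]mulnC [(outG * _)%N]mulnC.
Qed.

Lemma outG1 s : outG = 1%N -> s \in Aut U -> exists2 g, g \in 'N_G(U) & s = conj_aut U g.
Proof.
move=> n1 As; have /index1g E : #|Aut U : conj_aut U @* 'N_G(U)| = 1%N := n1.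
move: As; rewrite -E ?Aut_conj_aut // => /morphimP[g _ Ng ->].
by exists g.
Qed.
End OuterIndex.

Lemma tofrac_inj (R : idomainType) : injective (@tofrac R).
Proof. by move=> x y /eqP; rewrite tofrac_eq => /eqP. Qed.

Section Central.
Local Open Scope group_scope.
Local Open Scope ring_scope.
Variables (gT : finGroupType) (G : {group gT}) (R : idomainType).
Local Notation K := {fraction R}.
Hypothesis nzGR : #|G|%:R != 0 :> R.
Implicit Types (f : {ffun {group gT * gT} -> K}) (M : {group gT * gT}) (H U N : {group gT}).

Let nzK : #|G|%:R != 0 :> K := nzGK nzGR.

Definition bcentral f := forall y, inRBD G y -> bcomm G f y.

Lemma conjGP (A B : {set gT}) : reflect (exists2 g, g \in G & A = (B :^ g)%g) (conjG G A B).
Proof. by apply: (iffP exists_inP) => -[g Gg /eqP E]; exists g => //; apply/eqP. Qed.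

Lemma conjG_refl (A : {set gT}) : conjG G A A.
Proof. by apply/conjGP; exists 1%g; rewrite ?conjsg1. Qed.

Lemma conjG_sym (A B : {set gT}) : conjG G A B -> conjG G B A.
Proof. by case/conjGP=> g Gg ->; apply/conjGP; exists g^-1%g; rewrite ?groupV ?conjsgK. Qed.

Lemma conjG_trans (A B C : {set gT}) : conjG G A B -> conjG G B C -> conjG G A C.
Proof.
case/conjGP=> g Gg -> /conjGP[h Gh ->]; apply/conjGP; exists (h * g)%g; rewrite ?groupM //.
by rewrite conjsgM.
Qed.

Lemma conjGJ (A B : {set gT}) g : g \in G -> conjG G (A :^ g)%g B = conjG G A B.
Proof.
move=> Gg; have AgA : conjG G (A :^ g)%g A by apply/conjGP; exists g.
by apply/idP/idP; apply: conjG_trans => //; apply: conjG_sym.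
Qed.

Lemma nonbifree0 f c M : isB G f -> (bifree G M -> bmk G f M = c * (ucount G M)%:R) ->
  M \subset GG G -> bmk G f M = c * (ucount G M)%:R.
Proof.
move=> Bf H sM; have [//|nM] := boolP (bifree G M).
rewrite isB_bmk0 // (_ : ucount G M = 0%N) ?mulr0 //.
by apply/eqP; apply: contraR nM; apply: ucount_bifree.
Qed.

Lemma central_offdiag f M : inRBD G f -> bcentral f -> bifree G M ->
  ~~ conjG G (fst @* M)%g (snd @* M)%g -> bmk G f M = 0.
Proof.
move=> Rf Cf fM nc; have sM := bifree_sub fM.
(* Indicator of the conjugacy class of the source of M. Scaled by |G| it is the mark function of an
   element over R, and |G| is cancelled again in K. *)
pose d H : R := ((H \subset G) && conjG G H (snd @* M)%g)%:R.
have [|H /negbTE nH|r [_ Er]] := marks_surj_scaled nzGR (d := d).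
- by move=> H g Gg; rewrite /d /= conjG_sub // conjGJ.
- by rewrite /d nH.
pose y := fr (Dlt G r).
have Ry : inRBD G y := inRBD_fr (@bsupp_Dlt _ _ _ r).
pose c H : K := #|G|%:R * (tofrac (d H)).
have sy : scal G y c.
  move=> N sN; rewrite bmk_fr bmk_Dlt Er ?snd_sub // !rmorphM !rmorph_nat mulrC.
  by rewrite /c /d rmorph_nat.
have cJ : cinv G c by move=> H g Gg; rewrite /c /d /= conjG_sub // conjGJ.
have := Cf y Ry M sM.
rewrite (conv_r nzK (inRBD_isB Ry) (inRBD_isB Rf) sy sM fM).
rewrite (conv_l nzK (inRBD_isB Ry) (inRBD_isB Rf) sy cJ sM fM).
rewrite /c /d /= snd_sub // conjG_refl (negbTE nc) andbF rmorph0 rmorph1 mulr0 mul0r mulr1.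
by move/eqP; rewrite mulf_eq0 (negbTE nzK) => /eqP.
Qed.

(** The test element has mark |G x G| on the class of M and 0 off it. Its support lies in subgroups
    of conjugates of M, so it is bifree, and its nonzero mark at M can be cancelled from the
    commutation relation. *)
Lemma central_iso f c M : inRBD G f -> bcentral f -> scal G f c -> cinv G c -> bifree G M ->
  c (snd @* M)%G = c (fst @* M)%G.
Proof.
move=> Rf Cf sf cJ fM; have sM := bifree_sub fM.
pose d (N : {group gT * gT}) : R := (conjG (GGg G) N M)%:R.
have nzGGR : #|GGg G|%:R != 0 :> R by rewrite cardsX natrM mulf_neq0.
have cM (N : {group gT * gT}) : conjG (GGg G) N M -> bifree G N.
  case/exists_inP=> g Gg /eqP E; have := bifreeJ Gg fM; rewrite /bifree /=.
  by rewrite -E.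
have [|N nN|r [rsub Er]] := marks_surj_scaled nzGGR (d := d).
- move=> N g Gg; congr (_%:R); congr (nat_of_bool _); apply/exists_inP/exists_inP =>
  -[h Gh /eqP E].
    by exists (h * g^-1)%g; rewrite ?groupM ?groupV //= conjsgM -E conjsgK.
  by exists (h * g)%g; rewrite ?groupM //= conjsgM E.
- by rewrite /d; case: (boolP (conjG _ _ _)) => // /cM/bifree_sub; rewrite (negbTE nN).
have Ry : inRBD G (fr r).
  apply: inRBD_fr => L /rsub[N sLN]; rewrite /d; case: (boolP (conjG _ _ _));
    last by rewrite eqxx.
  by move=> /cM fN _; apply: bifreeS fN.
have := Cf _ Ry M sM.
rewrite (conv_r nzK (inRBD_isB Rf) (inRBD_isB Ry) sf sM fM).
rewrite (conv_l nzK (inRBD_isB Rf) (inRBD_isB Ry) sf cJ sM fM).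
rewrite bmk_fr bmkE Er // /d (_ : conjG _ _ _) ?mulr1; last first.
  by apply/exists_inP; exists 1%g; rewrite ?conjsg1.
by move/esym/mulIf; apply; rewrite tofrac_eq0.
Qed.

Lemma bone_Dlt : bone G K = Dlt G (gdelta G 1).
Proof.
apply/ffunP=> L; rewrite !ffunE; case: eqP => [E|nE].
  rewrite (big_pred1 G) ?ffunE ?eqxx // => U /=; apply/andP/eqP => [[sU /eqP EU]|->].
    apply/val_inj; rewrite /= -(snd_diag G) -(snd_diag U); congr (snd @* _)%g.
    by rewrite -EU E.
  by rewrite subxx E eqxx.
rewrite big1 // => U /andP[sU /eqP EU]; rewrite ffunE; case: eqP => // eU.
by case: nE; rewrite EU eU.
Qed.

Lemma scal_bone : scal G (bone G K) (fun=> 1).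
Proof.
move=> M sM; rewrite bone_Dlt bmk_Dlt gmk_delta // gmark_top ?snd_sub //.
by rewrite !mulr1 mul1r.
Qed.

Lemma isB_bone : isB G (bone G K).
Proof. by rewrite bone_Dlt; apply: isB_Dlt. Qed.

Lemma pmk_1l f M : isB G f -> M \subset GG G -> pmk G (bone G K) f M = bmk G f M.
Proof.
move=> Bf sM; have [fM|nM] := boolP (bifree G M).
  by rewrite (conv_l nzK isB_bone Bf scal_bone) // mul1r.
by have [-> //] := pmk_conv nzK isB_bone Bf sM; rewrite isB_bmk0.
Qed.

Lemma pmk_1r f M : isB G f -> M \subset GG G -> pmk G f (bone G K) M = bmk G f M.
Proof.
move=> Bf sM; have [fM|nM] := boolP (bifree G M).
  by rewrite (conv_r nzK isB_bone Bf scal_bone) // mul1r.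
by have [-> //] := pmk_conv nzK Bf isB_bone sM; rewrite isB_bmk0.
Qed.

Lemma bidem_compl f : isB G f -> bidem G f -> bidem G (bone G K - f).
Proof.
move=> Bf If M sM; have B1f : isB G (bone G K - f) by apply: isBD isB_bone (isBN Bf).
by rewrite pmkBl pmk_1l // pmkBr pmk_1r // If // subrr subr0.
Qed.

Lemma ucount_conjG M : ucount G M != 0%N -> conjG G (fst @* M)%g (snd @* M)%g.
Proof. by case/ucountP=> g Gg /fst_inner E; apply/conjGP; exists g. Qed.

Variable U : {group gT}.
Hypothesis sUG : U \subset G.
Hypothesis hOut : forall p, prime p -> (p %| #|Out U|)%N -> (p%:R : R) != 0 /\ ~~ ((p%:R : R)
  \is a GRing.unit).

Lemma central_Aut f : inRBD G f -> bcentral f -> bidem G f ->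
  exists e : bool, forall s, s \in Aut U ->
    bmk G f (graph U s) = e%:R * (ucount G (graph U s))%:R.
Proof.
move=> Rf Cf If; have Bf := inRBD_isB Rf.
have f0 M : bifree G M -> ~~ conjG G (fst @* M)%g (snd @* M)%g -> bmk G f M = 0.
  exact: central_offdiag.
pose f1 := bone G K - f.
have Bf1 : isB G f1 := isBD isB_bone (isBN Bf).
have f1E M : M \subset GG G -> bmk G f1 M = (ucount G M)%:R - bmk G f M.
  by move=> sM; rewrite bmkD bmkN scal_bone // mul1r.
have f10 M : bifree G M -> ~~ conjG G (fst @* M)%g (snd @* M)%g -> bmk G f1 M = 0.
  move=> fM nc; rewrite f1E ?bifree_sub // f0 // subr0; apply/eqP.
  rewrite (_ : ucount G M = 0%N) //; apply/eqP; apply: contraR nc; apply: ucount_conjG.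
have idem := idem_graph sUG nzK Bf If f0.
have idem1 := idem_graph sUG nzK Bf1 (bidem_compl Bf If) f10.
have nzN : #|'N_G(U)|%:R != 0 :> K := subG_nz nzK (subsetIl G 'N(U)).
have nzC : #|'C_G(U)|%:R != 0 :> K := subG_nz nzK (subsetIl G 'C(U)).
have [r [Er r0]] := conv_idem_rank nzN idem.
have [q [Eq q0]] := conv_idem_rank nzN idem1.
have [rho Erho] := mark_integral nzGR Rf sUG.
rewrite graph1 Erho in Er.
rewrite graph1 f1E ?(bifree_sub (diag_bifree sUG)) // ucount_diag Erho in Eq.
have card := card_outG G U; move: card; set n := outG G U => card.
have cardK : #|Aut U|%:R * #|'C_G(U)|%:R = n%:R * #|'N_G(U)|%:R :> K.
  by rewrite -!natrM card.
have Er' : r%:R = n%:R * rho :> R.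
  apply: tofrac_inj; rewrite rmorphM !rmorph_nat; apply: (mulfI nzN).
  by rewrite -Er mulrA cardK; ring.
have Eq' : q%:R = n%:R * (1 - rho) :> R.
  apply: tofrac_inj; rewrite rmorphM rmorphB rmorph1 !rmorph_nat; apply: (mulfI nzN).
  rewrite -Eq; transitivity (#|Aut U|%:R * #|'C_G(U)|%:R * (1 - tofrac rho));
    last by rewrite cardK; ring.
  by ring.
have n_gt0 : (0 < n)%N by rewrite indexg_gt0.
have [n_gt1|n_le1] := ltnP 1 n.
  have Hp p : prime p -> (p %| n)%N -> (p%:R : R) != 0 /\ ~~ ((p%:R : R) \is a GRing.unit).
    by move=> pr_p dv; apply: hOut => //; apply: dvdn_trans dv (outG_dvd sUG).
  (* Rank 0 for f makes f vanish on Aut(U); rank 0 for 1 - f makes f agree there with the unit,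
     whose marks are [ucount]. *)
  have [z|z] := nat_multiple_extreme n_gt1 Hp Er' Eq'.
    by exists false => s As; rewrite mul0r r0.
  exists true => s As; have := q0 z s As.
  rewrite (f1E (graph_group As)); last exact: bifree_sub (graph_bifree sUG As).
  by move/eqP; rewrite subr_eq0 mul1r => /eqP.
(* Now every automorphism of U is induced by G, so f has the same mark at all graphs, and
   idempotency at the identity gives rho^2 = rho. *)
have n1 : n = 1%N by apply/eqP; rewrite eqn_leq n_le1.
have inner s : s \in Aut U -> exists2 g, g \in G & graph U s = (diag U :^ (g, 1))%g.
  move=> As; have [g /setIP[Gg Ng] Es] := outG1 n1 As; exists g => //.
  apply/setP=> -[x y]; rewrite mem_graph (@memJ_pair _ (diag_group U)) mem_diag invg1 conjg1.
  rewrite Es -(inj_eq (@conjg_inj _ g) (x ^ g^-1)%g) conjgKV.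
  by case Uy: (y \in U); rewrite ?andbF // norm_conj_autE.
have aE s : s \in Aut U -> bmk G f (graph U s) = #|'C_G(U)|%:R * tofrac rho.
  case/inner=> g Gg ->; rewrite (@bmkJ _ _ _ _ (diag_group U)) ?Erho //.
  by rewrite memGG Gg group1.
have uE s : s \in Aut U -> ucount G (graph U s) = #|'C_G(U)|.
  by case/inner=> g Gg ->; rewrite (@ucountJ _ _ (diag_group U)) ?ucount_diag.
have rr : rho * rho = rho.
  have := idem 1%g (group1 _).
  rewrite (eq_bigr (fun=> (#|'C_G(U)|%:R * tofrac rho) * (#|'C_G(U)|%:R * tofrac rho)));
    last first.
    by move=> t At; rewrite mulg1 !aE ?groupV.
  rewrite sumr_const -mulr_natl aE // => E; apply: tofrac_inj; rewrite rmorphM.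
  apply: (mulfI nzN); apply: (mulfI nzC); rewrite [RHS]mulrCA -E.
  transitivity (#|'N_G(U)|%:R * #|'C_G(U)|%:R * (tofrac rho * tofrac rho)); first by ring.
  have <- : #|Aut U|%:R * #|'C_G(U)|%:R = #|'N_G(U)|%:R :> K by rewrite cardK n1 mul1r.
  by ring.
have : rho * (rho - 1) == 0 by rewrite mulrBr rr mulr1 subrr.
rewrite mulf_eq0 subr_eq0 => /orP[/eqP z|/eqP z].
  by exists false => s As; rewrite aE // z rmorph0 mulr0 mul0r.
by exists true => s As; rewrite aE // uE // z rmorph1 mulr1 mul1r.
Qed.

(** If the target of M is conjugate to U, conjugating it back turns M into the graph of an
    automorphism of U; at all other M both sides vanish. *)
Lemma central_block f : inRBD G f -> bcentral f -> bidem G f ->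
  exists e : bool, forall M, M \subset GG G -> snd @* M = U ->
    bmk G f M = e%:R * (ucount G M)%:R.
Proof.
move=> Rf Cf If; have [e E] := central_Aut Rf Cf If; exists e => M sM EM.
apply: nonbifree0 => //; first exact: inRBD_isB.
move=> fM; have [|nc] := boolP (conjG G (fst @* M)%g (snd @* M)%g); last first.
  rewrite central_offdiag // (_ : ucount G M = 0%N) ?mulr0 //.
  by apply/eqP; apply: contraR nc; apply: ucount_conjG.
rewrite EM => /conjGP[g Gg Eg].
have GGg1 : (g^-1%g, 1%g) \in GGg G by rewrite memGG groupV Gg group1.
have [||s As Es] := @bifree_graph _ G U (M :^ (g^-1%g, 1%g))%G (bifreeJ GGg1 fM).
- by rewrite /= fst_conj Eg conjsgK.
- by rewrite /= snd_conj EM conjsg1.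
by rewrite -(bmkJ _ _ GGg1) -(@ucountJ _ G M g^-1%g 1%g) ?groupV // [(M :^ _)%g]Es E.
Qed.

End Central.

(** * Solvable pi-residues *)

Section PiResidue.
Local Open Scope group_scope.
Variables (gT : finGroupType) (pi : nat_pred).
Implicit Types (U N P Q D H : {group gT}).

Definition solpi N U := [&& N <| U, solvable (U / N) & pi.-group (U / N)].

Lemma solpi_normal N U : solpi N U -> N <| U. Proof. by case/and3P. Qed.

Lemma solpi_refl U : solpi U U.
Proof. by rewrite /solpi normal_refl trivg_quotient solvable1 pgroup1. Qed.

Lemma solpi_trans D N P : D <| P -> D \subset N -> solpi N P -> solpi D N -> solpi D P.
Proof.
move=> nDP sDN /and3P[nNP solP piP] /and3P[nDN solN piN]; apply/and3P; split=> //.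
  by rewrite (series_sol (quotient_normal D nNP)) solN (isog_sol (third_isog sDN nDP nNP)).
move: piP piN; rewrite /pgroup !card_quotient ?normal_norm // => piP piN.
by rewrite -(Lagrange_index (normal_sub nNP) sDN) pnatM piP.
Qed.

Lemma solpiI N P Q : Q \subset P -> solpi N P -> solpi (N :&: Q) Q.
Proof.
move=> sQP /and3P[nNP solP piP]; have nNQ := subset_trans sQP (normal_norm nNP).
have iso := second_isog nNQ; apply/and3P; split.
- by rewrite /= setIC; apply: normalGI sQP nNP.
- by rewrite (isog_sol iso) (solvableS _ solP) // quotientS.
- by rewrite /pgroup (card_isog iso); apply: pgroupS piP; apply: quotientS.
Qed.

Lemma solpiII N1 N2 U : solpi N1 U -> solpi N2 U -> solpi (N2 :&: N1) U.
Proof.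
move=> g1 g2; have [n1 n2] := (solpi_normal g1, solpi_normal g2).
apply: solpi_trans g1 (solpiI (normal_sub n1) g2); last exact: subsetIr.
by apply: normalI.
Qed.

Lemma piRes_group_set (U : {set gT}) : group_set (piRes pi U).
Proof. exact: group_set_bigcap. Qed.
Canonical piRes_group (U : {set gT}) := group (piRes_group_set U).

Lemma piRes_min N U : solpi N U -> piRes pi U \subset N.
Proof. by move=> g; apply: bigcap_inf. Qed.

(** Normal subgroups with solvable pi-quotient are closed under intersection, so a smallest one is
    contained in all others and is the residue. *)
Lemma piRes_solpi U : solpi (piRes_group U) U.
Proof.
case: (@arg_minnP _ U (fun N => solpi N U) (fun N : {group gT} => #|N|) (solpi_refl U)) =>
  D gD minD.
suff -> : piRes_group U = D by [].
apply/val_inj/eqP; rewrite eqEsubset piRes_min //=; apply/bigcapsP=> N gN.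
have /minD le := solpiII gD gN; have sI := subsetIr N D.
by have /eqP <- : N :&: D == D; [rewrite eqEcard sI | apply: subsetIl].
Qed.

Lemma piRes_sub U : piRes pi U \subset U.
Proof. by rewrite piRes_min ?solpi_refl. Qed.

End PiResidue.

Section PiResidueMorphism.
Local Open Scope group_scope.
Variables (pi : nat_pred).

Lemma solpi_morphim (aT rT : finGroupType) (N U : {group aT}) (f : {morphism U >-> rT}) :
  solpi pi N U -> solpi pi (f @* N) (f @* U).
Proof.
case/and3P=> nNU solU piU; pose q := quotm_morphism f nNU.
have E : q @* (U / N) = f @* U / f @* N by rewrite morphim_quotm.
apply/and3P; split; first exact: morphim_normal.
  by rewrite -E morphim_sol.
by rewrite -E morphim_pgroup.
Qed.

Lemma card_piRes_le (aT rT : finGroupType) (U : {group aT}) (V : {group rT}) :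
  U \isog V -> (#|piRes pi V| <= #|piRes pi U|)%N.
Proof.
case/isogP=> f injf <-; rewrite -(card_injm injf (piRes_sub pi U)) subset_leq_card //.
exact: piRes_min (solpi_morphim f (piRes_solpi pi U)).
Qed.

(** The image of the residue is one of the subgroups intersected, which gives an inclusion;
    comparing orders through the inverse isomorphism gives equality. *)
Lemma piRes_morphim (aT rT : finGroupType) (U : {group aT}) (f : {morphism U >-> rT}) :
  'injm f -> piRes pi (f @* U) = f @* piRes pi U.
Proof.
move=> injf; apply/eqP; rewrite eqEcard (piRes_min (solpi_morphim f (piRes_solpi pi U))) /=.
rewrite (card_injm injf) ?piRes_sub // card_piRes_le // isog_sym.
by apply/isogP; exists f.
Qed.

Lemma piRes_isog (aT rT : finGroupType) (U : {group aT}) (V : {group rT}) :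
  U \isog V -> piRes pi U \isog piRes pi V.
Proof.
case/isogP=> f injf <-; rewrite piRes_morphim //.
by apply: sub_isog; rewrite ?piRes_sub.
Qed.

Variables (gT : finGroupType).
Implicit Types (U N P D H : {group gT}).

Lemma piResJ U x : piRes pi (U :^ x) = piRes pi U :^ x.
Proof.
have := piRes_morphim (injm_conj U x); rewrite !morphim_conj setIid.
by rewrite (setIidPr (piRes_sub pi U)).
Qed.

(** The residue of N is preserved by conjugation under P, hence normal in P, and its quotient in P
    is an extension of solvable pi-groups. Conversely, the residue of P meets N in a subgroup
    admissible for N. *)
Lemma piRes_ext N P : solpi pi N P -> piRes pi P = piRes pi N.
Proof.
move=> g; have nNP := solpi_normal g; apply/eqP; rewrite eqEsubset; apply/andP; split.
  apply: (@piRes_min _ _ (piRes_group pi N)); apply: solpi_trans g (piRes_solpi pi N);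
    last exact: piRes_sub.
  rewrite /normal (subset_trans (piRes_sub _ _) (normal_sub nNP)) /=.
  apply/subsetP=> x Px; rewrite inE -piResJ (normsP (normal_norm nNP)) //.
apply: subset_trans (piRes_min (solpiI (normal_sub nNP) (piRes_solpi pi P))) _.
exact: subsetIl.
Qed.

Lemma solpi_prime N U : N <| U -> prime #|U / N| -> #|U / N| \in pi -> solpi pi N U.
Proof.
move=> nNU pr piN; apply/and3P; split=> //.
  by rewrite abelian_sol // cyclic_abelian // prime_cyclic.
by rewrite /pgroup pnatE.
Qed.

(** A nontrivial solvable pi-group has a quotient of prime order, and that prime lies in pi. *)
Lemma pi_perfectP U : reflect (piRes pi U = U) (pi_perfect pi U).
Proof.
apply: (iffP forallP) => [H|E N]; last first.
  apply/implyP=> nNU; apply/negP => /andP[pr piN].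
  have := piRes_min (solpi_prime nNU pr piN); rewrite E => sUN.
  by move: pr; rewrite (quotientS1 sUN) cards1.
apply/eqP; apply: contraT => nE; have := piRes_solpi pi U; set D := piRes_group pi U.
case/and3P=> nDU solU piU.
have nt : U / D != 1.
  apply: contra nE => /eqP/trivgP; rewrite quotient_sub1 ?normal_norm // => sUD.
  by rewrite eqEsubset piRes_sub.
have [Q nQ pr] := sol_prime_factor_exists solU nt.
have [N EN sDN nNU] := inv_quotientN nDU nQ.
have cE : #|U / N| = #|U / D : Q|.
  by rewrite EN -card_quotient ?quotient_norms ?normal_norm // (card_isog (third_isog sDN nDU
    nNU)).
have := H N; rewrite nNU cE pr /= => /negP[].
apply: (pgroupP piU _ pr); apply: dvdn_indexg.
Qed.

Lemma piRes_id U : piRes pi (piRes pi U) = piRes pi U.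
Proof. by rewrite -(piRes_ext (piRes_solpi pi U)). Qed.

(** Descend through normal subgroups of prime index in pi until a pi-perfect group is reached; by
    [piRes_ext] the residue does not change on the way. *)
Lemma piRes_invariant (T : Type) (c : {group gT} -> T) (G : {group gT}) :
    (forall N U, N <| U -> U \subset G -> prime #|U / N| -> #|U / N| \in pi -> c N = c U) ->
  forall U, U \subset G -> c (piRes_group pi U) = c U.
Proof.
move=> Hc U; move: {2}#|U| (leqnn #|U|) => n; elim: n U => [|n IH] U le sUG.
  by move: le; rewrite leqNgt cardG_gt0.
have [/pi_perfectP E|] := boolP (pi_perfect pi U); first by congr c; apply: val_inj.
rewrite negb_forall => /existsP[N]; rewrite negb_imply negbK => /andP[nNU /andP[pr piN]].
rewrite -(Hc N U) // -(IH N).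
- by congr c; apply: val_inj; apply: piRes_ext; apply: solpi_prime.
- rewrite -ltnS; apply: leq_trans le; rewrite proper_card // properEneq normal_sub // andbT.
  by apply: contraTneq pr => ->; rewrite trivg_quotient cards1.
- exact: subset_trans (normal_sub nNU) sUG.
Qed.

End PiResidueMorphism.

(** * Scalars of central idempotents under isomorphisms and residues *)

Section CentralScalar.
Local Open Scope group_scope.
Local Open Scope ring_scope.
Variables (gT : finGroupType) (G : {group gT}) (R : idomainType).
Local Notation K := {fraction R}.
Hypothesis nzGR : #|G|%:R != 0 :> R.
Hypothesis hOut : forall U : {group gT}, U \subset G -> forall p : nat, prime p ->
     (p %| #|Out U|)%N -> (p%:R : R) != 0 /\ ~~ ((p%:R : R) \is a GRing.unit).
Implicit Types (f : {ffun {group gT * gT} -> K}) (M : {group gT * gT}) (H U N : {group gT}).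

Let nzK : #|G|%:R != 0 :> K := nzGK nzGR.

(** [ucount] at Delta(H) is |C_G(H)|, so this reads off the scalar of f at H whenever f acts by
    scalars. *)
Definition cval f H : K := bmk G f (diag H) / #|'C_G(H)|%:R.

Lemma nz_cent H : #|'C_G(H)|%:R != 0 :> K.
Proof. exact (subG_nz nzK (subsetIl G 'C(H))). Qed.

Lemma cinv_cval f : cinv G (cval f).
Proof.
move=> H g Gg; rewrite /cval; congr (_ / _%:R).
  have -> : diag (H :^ g)%G = (diag_group H :^ (g, g))%g.
    by apply/setP=> -[x y]; rewrite memJ_pair !mem_diag /= mem_conjg (inj_eq (@conjg_inj _ _)).
  by rewrite bmkJ // memGG Gg.
by rewrite /= -{1}(conjGid Gg) centJ -conjIg cardJg.
Qed.

Lemma scal_cval f c U : scal G f c -> U \subset G -> cval f U = c U.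
Proof.
move=> sf sUG; rewrite /cval (sf (diag_group U)) ?bifree_sub ?diag_bifree // ucount_diag.
rewrite mulfK ?nz_cent //; congr (c _); apply/val_inj; exact: snd_diag.
Qed.

Lemma central_block_cval f U : central_idem G f -> U \subset G ->
  exists2 e : bool, cval f U = e%:R & forall M, M \subset GG G -> snd @* M = U ->
    bmk G f M = e%:R * (ucount G M)%:R.
Proof.
case=> -[Rf Cf] If sUG; have [e E] := central_block nzGR sUG (hOut sUG) Rf Cf If.
exists e => //; rewrite /cval (E (diag_group U)) ?bifree_sub ?diag_bifree ?snd_diag //.
by rewrite ucount_diag mulfK ?nz_cent.
Qed.

Lemma cval_bool f U : central_idem G f -> U \subset G -> exists e : bool, cval f U = e%:R.
Proof. by move=> Zf sUG; have [e] := central_block_cval Zf sUG; exists e. Qed.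

Lemma cval_scal f : central_idem G f -> scal G f (cval f).
Proof.
move=> Zf M sM; have [e Ee E] := central_block_cval Zf (snd_sub sM).
by rewrite E // -Ee.
Qed.

Lemma cval_iso f M : central_idem G f -> bifree G M -> cval f (snd @* M)%G = cval f (fst @* M)%G.
Proof.
by move=> Zf; have [[Rf Cf] _] := Zf; apply: (central_iso nzGR Rf Cf (cval_scal Zf) (cinv_cval
  f)).
Qed.

Lemma cval_isog f (U V : {group gT}) : central_idem G f -> U \subset G -> V \subset G ->
  U \isog V -> cval f U = cval f V.
Proof.
move=> Zf sU sV /isogP[h injh EV].
pose M0 := [set (h u, u) | u in U].
have mem x y : ((x, y) \in M0) = (x == h y) && (y \in U).
  apply/imsetP/andP => [[u Uu [-> ->]]|[/eqP-> Uy]]; first by rewrite eqxx.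
  by exists y.
have gM : group_set M0.
  apply/group_setP; split=> [|[a b] [c d]]; first by rewrite mem morph1 eqxx group1.
  by rewrite !mem => /andP[/eqP-> Ub] /andP[/eqP-> Ud]; rewrite /= morphM ?groupM ?eqxx.
pose M := Group gM; have memM x y : ((x, y) \in M) = (x == h y) && (y \in U) := mem x y.
have fM : bifree G M.
  apply/bifreeP; split.
  - apply/subsetP=> -[x y]; rewrite memM memGG => /andP[/eqP-> Uy].
    by rewrite (subsetP sU y Uy) (subsetP sV) // -EV mem_morphim.
  - by move=> x; rewrite memM => /andP[/eqP-> _]; rewrite morph1.
  - by move=> x; rewrite memM => /andP[/eqP/esym E Ux]; apply/eqP;
    rewrite -(morph_injm_eq1 injh) // E.
have := cval_iso Zf fM.
have -> : (snd @* M)%G = U.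
  apply/val_inj/setP=> y; apply/mem_p2/idP => [[x]|Uy]; first by rewrite memM => /andP[].
  by exists (h y); rewrite memM eqxx.
have -> // : (fst @* M)%G = V.
apply: val_inj; rewrite -[RHS]EV; apply/setP=> x; apply/mem_p1/morphimP => [[y]|[y _ Uy ->]].
  by rewrite memM => /andP[/eqP-> Uy]; exists y.
by exists y; rewrite memM eqxx.
Qed.

(** Two values in {0, 1} that differ would have difference 1 or -1, and the congruence would make
    the index invertible in R. *)
Lemma cval_index f N U : central_idem G f -> N <| U -> U \subset G -> prime #|U / N|%g ->
  ~~ ((#|U / N|%g%:R : R) \is a GRing.unit) -> cval f N = cval f U.
Proof.
move=> Zf nNU sUG pr nu; have [[Rf _] _] := Zf.
have [rho] := scal_congr nzGR Rf (cval_scal Zf) nNU sUG pr.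
have [a ->] := cval_bool Zf (subset_trans (normal_sub nNU) sUG).
have [b ->] := cval_bool Zf sUG.
set q : R := #|U / N|%g%:R in nu *; have -> : #|U / N|%g%:R = tofrac q :> K by rewrite rmorph_nat.
rewrite -rmorphM; case: a; case: b => //; rewrite ?subr0 ?sub0r => E.
  by case/negP: nu; apply/unitrPr; exists rho; apply: tofrac_inj; rewrite -E rmorph1.
case/negP: nu; apply/unitrPr; exists (- rho); apply: tofrac_inj.
by rewrite mulrN rmorphN -E opprK rmorph1.
Qed.

Lemma cval_piRes f U : central_idem G f -> U \subset G -> cval f (piRes_group (piG G R) U) =
  cval f U.
Proof.
move=> Zf; apply: (piRes_invariant (pi := piG G R) (c := cval f)) => N V nNV sVG pr.
by rewrite inE => /and3P[_ _ nu]; apply: cval_index.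
Qed.

Lemma bifree_isog M : bifree G M -> fst @* M \isog snd @* M.
Proof.
move=> fM.
have injs : 'injm (restrm (subsetT M) (snd_morphism gT gT)).
  apply/injmP=> -[x y] [x' y'] Mx Mx' E; have {}E : y = y' := E.
  by subst y'; rewrite (bifree_inj1 fM Mx Mx').
have injf : 'injm (restrm (subsetT M) (fst_morphism gT gT)).
  apply/injmP=> -[x y] [x' y'] Mx Mx' E; have {}E : x = x' := E.
  by subst x'; rewrite (bifree_inj2 fM Mx Mx').
apply: (@isog_trans _ _ _ _ M); first rewrite isog_sym; apply/isogP.
  by exists [morphism of restrm (subsetT M) (fst_morphism gT gT)] => //;
    rewrite morphim_restrm setIid.
by exists [morphism of restrm (subsetT M) (snd_morphism gT gT)] => //;
  rewrite morphim_restrm setIid.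
Qed.

(** At a twisted diagonal f multiplies by c of the target on one side and by c of the source on the
    other; these are isomorphic groups, so isomorphism invariance of c gives centrality. *)
Lemma scal_central f c : inRBD G f -> scal G f c -> cinv G c ->
    (forall U V : {group gT}, U \subset G -> V \subset G -> U \isog V -> c U = c V) ->
    (forall U, U \subset G -> c U * c U = c U) ->
  central_idem G f.
Proof.
move=> Rf sf cJ ciso cc; have Bf := inRBD_isB Rf; split.
  split=> // y Ry N sN; have By := inRBD_isB Ry.
  have [fN|nN] := boolP (bifree G N); last first.
    by have [-> // _] := pmk_conv nzK Bf By sN; have [-> // _] := pmk_conv nzK By Bf sN.
  rewrite (conv_l nzK Bf By sf cJ sN fN) (conv_r nzK Bf By sf sN fN); congr (_ * _).
  apply: ciso; rewrite ?fst_sub ?snd_sub //.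
  exact: bifree_isog fN.
by move=> N sN; rewrite (scal_pmk nzK Bf Bf sf sf sN) sf // cc // snd_sub.
Qed.

End CentralScalar.

(** * The idempotents *)

Section Idempotents.
Local Open Scope group_scope.
Local Open Scope ring_scope.
Variables (gT : finGroupType) (G : {group gT}) (R : idomainType).
Local Notation K := {fraction R}.
Local Notation pi := (piG G R).
Hypothesis nzGR : #|G|%:R != 0 :> R.
Hypothesis hOut : forall U : {group gT}, U \subset G -> forall p : nat, prime p ->
     (p %| #|Out U|)%N -> (p%:R : R) != 0 /\ ~~ ((p%:R : R) \is a GRing.unit).
Implicit Types (f e : {ffun {group gT * gT} -> K}) (x : {ffun {group gT} -> K}).
Implicit Types (M : {group gT * gT}) (H U V W N : {group gT}).

Let nzK : #|G|%:R != 0 :> K := nzGK nzGR.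

Definition ceps W H : K := (piRes pi H \isog W)%:R.

Lemma piRes_conj_isog W H g : (piRes pi (H :^ g) \isog W) = (piRes pi H \isog W).
Proof.
rewrite piResJ; apply/esym.
exact: (@isog_transl _ _ _ (piRes_group pi H) (piRes_group pi H :^ g) W (conj_isog _ g)).
Qed.

(** One V' in [Sig] represents H and one V represents the residue of V', so the double sum has at
    most one nonzero term, present exactly when V is isomorphic to W. *)
Lemma eps_sum (Sig : {set {group gT}}) W H : conj_reps G Sig -> H \subset G ->
  (\sum_(V in Theta_t pi Sig | V \isog W)
     \sum_(V' in Sig | conjG G (piRes pi V') V) (conjG G H V')%:R)%R = ceps W H.
Proof.
case=> SG Srep Suniq sHG.
have [V' SV' cV'] := Srep H sHG.
have sV' : piRes_group pi V' \subset G by apply: subset_trans (piRes_sub pi V') (SG _ SV').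
have [V SV cV] := Srep _ sV'.
have inner W' : \sum_(V'' in Sig | conjG G (piRes pi V'') W') (conjG G H V'')%:R
    = (conjG G (piRes pi V') W')%:R :> K.
  rewrite big_mkcondr (bigD1 V') //= big1 ?addr0 => [|V'' /andP[SV'' nV]].
    by rewrite cV'; case: ifP.
  case: ifP => // _; case: (boolP (conjG G H V'')) => // c.
  by case/eqP: nV; apply: Suniq => //; apply: conjG_trans (conjG_sym c) cV'.
rewrite (eq_bigr _ (fun W' _ => inner W')).
have isoV : (V \isog W) = (piRes pi H \isog W).
  case/conjGP: cV' => g _ EH; rewrite EH piRes_conj_isog.
  case/conjGP: cV => h _ /= EV; apply/esym.
  have -> : piRes pi V' = (V :^ h)%G by [].
  by apply: isog_transl; rewrite isog_sym conj_isog.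
have perfV : pi_perfect pi V.
  apply/pi_perfectP; case/conjGP: cV => h _ /= EV.
  by apply: (@conjsg_inj _ h); rewrite -piResJ -EV piRes_id.
rewrite /ceps -isoV; case isoVW: (V \isog W); last first.
  rewrite big1 // => W' /andP[]; rewrite inE => /andP[SW' _] iso.
  case: (boolP (conjG _ _ _)) => // c.
  have E : V = W' by apply: Suniq => //; apply: conjG_trans (conjG_sym cV) c.
  by rewrite E iso in isoVW.
rewrite (bigD1 V) /=; last by rewrite inE SV perfV.
rewrite cV big1 ?addr0 // => W' /andP[/andP[]]; rewrite inE => /andP[SW' _] _ nV.
case: (boolP (conjG _ _ _)) => // c; case/eqP: nV; apply: Suniq => //.
exact: conjG_trans (conjG_sym c) cV.
Qed.

Lemma eps_integral W : exists r : {ffun {group gT} -> R},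
  forall H, H \subset G -> gmk G r H = (piRes pi H \isog W)%:R.
Proof.
pose d H : R := ((H \subset G) && (piRes pi H \isog W))%:R.
have [|H /negbTE nH|p pr_p dvp|r [_ Er]] := marks_surj nzGR (d := d).
- by move=> H g Gg; rewrite /d /= conjG_sub // piRes_conj_isog.
- by rewrite /d nH.
- have [u|nu] := boolP ((p%:R : R) \is a GRing.unit); [by left | right => U P nUP sPG pP].
  have pip : p \in pi by rewrite inE pr_p dvp nu.
  (* For p in pi all U<g> with g in P have the residue of U, so the sum is |P| d(U). *)
  exists (d U); rewrite mulr_natr -sumr_const; apply: eq_bigr => g Pg; rewrite /d.
  have [sUP nUP'] := andP nUP.
  have sub : (U <*> <[g]> \subset P)%g by rewrite join_subG sUP cycle_subG.
  rewrite !(subset_trans _ sPG) //=.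
  have -> // : piRes pi (U <*> <[g]>)%G = piRes pi U.
  apply: piRes_ext; have pQ : p.-group ((U <*> <[g]>) / U)%g := pgroupS (quotientS U sub) pP.
  apply/and3P; split.
  - by rewrite /normal joing_subl (subset_trans sub).
  - exact: pgroup_sol pQ.
  - by apply: sub_pgroup pQ => q; rewrite inE => /eqP->.
by exists r => H sH; rewrite Er // /d sH.
Qed.

Lemma scal_eps W x : (forall H, H \subset G -> gmk G x H = ceps W H) -> scal G (Dlt G x) (ceps W).
Proof. by move=> E M sM; rewrite bmk_Dlt mulrC E ?snd_sub. Qed.

Lemma ceps_isog W U V : U \isog V -> ceps W U = ceps W V.
Proof.
move=> iso; rewrite /ceps; congr (_%:R); congr nat_of_bool.
exact: (@isog_transl _ _ _ (piRes_group pi U) (piRes_group pi V) W (piRes_isog pi iso)).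
Qed.

Lemma ceps_idem W U : ceps W U * ceps W U = ceps W U.
Proof. by rewrite /ceps; case: (_ \isog _); rewrite ?mulr1 ?mulr0. Qed.

Lemma cinv_ceps W : cinv G (ceps W).
Proof. by move=> H g _; rewrite /ceps /= piRes_conj_isog. Qed.

Lemma eps_central W x : (forall H, H \subset G -> gmk G x H = ceps W H) -> central_idem G (Dlt G
  x).
Proof.
move=> E; apply: (scal_central nzGR _ (scal_eps E) (@cinv_ceps W)).
- have [r Er] := eps_integral W; exists (Dlt G r); split; first exact: bsupp_Dlt.
  move=> N sN; rewrite -/(fr _) bmk_fr !bmk_Dlt E ?Er ?snd_sub //.
  by rewrite rmorphM !rmorph_nat.
- by move=> U V _ _; apply: ceps_isog.
- by move=> U _; apply: ceps_idem.
Qed.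

Lemma bzeroP f : central_idem G f -> bzero G f <-> (forall U, U \subset G -> cval G f U = 0).
Proof.
move=> Zf; split=> [z U sU|z N sN]; last by rewrite (cval_scal nzGR hOut Zf) // z ?snd_sub //
  mul0r bmk0.
by rewrite /cval (z (diag_group U)) ?bifree_sub ?diag_bifree // bmk0 mul0r.
Qed.

Lemma cval_eps W x U : (forall H, H \subset G -> gmk G x H = ceps W H) -> U \subset G ->
  cval G (Dlt G x) U = ceps W U.
Proof. by move=> E; apply: (scal_cval nzGR); apply: scal_eps. Qed.

Lemma borth_cval f e U : central_idem G f -> central_idem G e -> borth G f e -> U \subset G ->
  cval G f U * cval G e U = 0.
Proof.
move=> Zf Ze o sU; have sD := bifree_sub (diag_bifree sU).
have [[Rf _] _] := Zf; have [[Re _] _] := Ze.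
have := o _ sD.
rewrite (scal_pmk nzK (inRBD_isB Re) (inRBD_isB Rf) (cval_scal nzGR hOut Ze) (cval_scal nzGR
  hOut Zf)) //.
have -> : (snd @* diag_group U)%G = U by apply: val_inj; exact: snd_diag.
move/eqP; rewrite mulf_eq0 ucount_diag (negbTE (nz_cent nzGR U)) orbF mulrC.
by move/eqP.
Qed.

Lemma cval_beqD e f1 f2 U : beq G e (f1 + f2) -> U \subset G -> cval G e U = cval G f1 U + cval
  G f2 U.
Proof.
move=> E sU; rewrite /cval (E (diag_group U)) ?bifree_sub ?diag_bifree // bmkD.
by rewrite mulrDl.
Qed.

(** Where the residue is isomorphic to W, f1 takes its value at W, which is 0. Elsewhere f1 + f2
    vanishes, and orthogonality excludes that both values are 1, a case the sum alone would permit
    in characteristic 2. *)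
Lemma eps_indec W x f1 f2 : W \subset G ->
    (forall H, H \subset G -> gmk G x H = ceps W H) ->
    central_idem G f1 -> central_idem G f2 -> borth G f1 f2 -> beq G (Dlt G x) (f1 + f2) ->
  cval G f1 W = 0 -> bzero G f1.
Proof.
move=> sW E Z1 Z2 o D z; apply/bzeroP=> // U sU.
have := cval_beqD D sU; rewrite (cval_eps E sU) /ceps.
have [iso _|_] := boolP (piRes pi U \isog W).
  rewrite -z -(cval_piRes nzGR hOut Z1 sU); apply: cval_isog => //.
  exact: subset_trans (piRes_sub pi U) sU.
have := borth_cval Z1 Z2 o sU; have [[] ->] := cval_bool nzGR hOut Z1 sU => //.
by rewrite mul1r => ->; rewrite addr0 => /esym/eqP; rewrite oner_eq0.
Qed.

Lemma ceps_perfect W U : pi_perfect pi W -> W \isog U -> ceps U W = 1.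
Proof. by move=> /pi_perfectP EW iso; rewrite /ceps EW iso. Qed.

Lemma eps_neq0 W x : W \subset G -> pi_perfect pi W ->
  (forall H, H \subset G -> gmk G x H = ceps W H) -> ~ bzero G (Dlt G x).
Proof.
move=> sW pW E /(bzeroP (eps_central E))/(_ W sW);
  rewrite (cval_eps E sW) (ceps_perfect pW (isog_refl W)).
by move/eqP; rewrite oner_eq0.
Qed.

Lemma eps_prim W x : W \subset G -> pi_perfect pi W ->
  (forall H, H \subset G -> gmk G x H = ceps W H) -> prim_central_idem G (Dlt G x).
Proof.
move=> sW pW E; have Z := eps_central E; split=> //; first exact: eps_neq0 E.
move=> f1 f2 Z1 Z2 o D; have := borth_cval Z1 Z2 o sW.
have [[] E1] := cval_bool nzGR hOut Z1 sW; last by left; apply: (eps_indec sW E Z1 Z2 o D).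
rewrite E1 mul1r => E2; right; apply: (eps_indec sW E Z2 Z1) => //.
  (* [borth] is one-sided; centrality of f1 supplies the other order. *)
  move=> N sN; have [[_ C1] _] := Z1; have [[R2 _] _] := Z2.
  by rewrite -(C1 _ R2 N sN) o.
by move=> N sN; rewrite D // addrC.
Qed.

Lemma eps_orth W W' x x' : ~~ (W \isog W') ->
    (forall H, H \subset G -> gmk G x H = ceps W H) ->
    (forall H, H \subset G -> gmk G x' H = ceps W' H) ->
  borth G (Dlt G x) (Dlt G x').
Proof.
move=> niso E E' N sN.
rewrite (scal_pmk nzK (isB_Dlt _ _) (isB_Dlt _ _) (scal_eps E') (scal_eps E)) // /ceps.
case: (boolP (_ \isog W')) => iso'; last by rewrite mul0r mul0r.
case: (boolP (_ \isog W)) => iso; last by rewrite mulr0 mul0r.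
case/negP: niso; apply: isog_trans iso'.
by rewrite (@isog_sym _ _ W (piRes_group pi (snd @* N)%G)).
Qed.

(** Being 1 at U, e is 1 wherever the residue is isomorphic to W. Hence Delta(x) and e - Delta(x)
    are orthogonal central idempotents with sum e, and primitivity kills the second because the
    first is nonzero. *)
Lemma prim_eps e W x U : prim_central_idem G e -> U \subset G -> cval G e U != 0 ->
    W \subset G -> pi_perfect pi W -> piRes pi U \isog W ->
    (forall H, H \subset G -> gmk G x H = ceps W H) ->
  beq G e (Dlt G x).
Proof.
case=> Ze nze indec sU nzU sW pW isoU E; have Zx := eps_central E.
have [[Re _] _] := Ze; have [[Rx _] _] := Zx.
pose c2 H : K := cval G e H - ceps W H.
have s2 : scal G (e - Dlt G x) c2.
  by move=> N sN; rewrite bmkD bmkN (cval_scal nzGR hOut Ze) // (scal_eps E) // -mulrBl.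
have eU : cval G e U = 1.
  by have [[] Eb] := cval_bool nzGR hOut Ze sU; rewrite Eb // eqxx in nzU *.
have eE V : V \subset G -> ceps W V * cval G e V = ceps W V.
  move=> sV; rewrite /ceps; have [iso|_] := boolP (piRes pi V \isog W); last by rewrite mul0r.
  rewrite mul1r -eU -(cval_piRes nzGR hOut Ze sV) -(cval_piRes nzGR hOut Ze sU).
  apply: cval_isog => //; try exact: subset_trans (piRes_sub pi _) _.
  by apply: isog_trans iso _; rewrite (@isog_sym _ _ W (piRes_group pi U)).
have ee V : V \subset G -> cval G e V * cval G e V = cval G e V.
  by move=> sV; have [[] ->] := cval_bool nzGR hOut Ze sV; rewrite ?mulr1 ?mulr0.
have Z2 : central_idem G (e - Dlt G x).
  apply: (scal_central nzGR (inRBD_B Re Rx) s2).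
  - by move=> H g Gg; rewrite /c2 cinv_cval // cinv_ceps.
  - by move=> V V' sV sV' iso; rewrite /c2 (cval_isog nzGR hOut Ze sV sV' iso) (ceps_isog W iso).
  - move=> V sV; rewrite /c2 mulrBl !mulrBr ee // eE // ceps_idem mulrC eE //.
    by rewrite subrr subr0.
have o : borth G (Dlt G x) (e - Dlt G x).
  move=> N sN; have sS := snd_sub sN.
  rewrite (scal_pmk nzK (isBD (inRBD_isB Re) (isBN (inRBD_isB Rx))) (inRBD_isB Rx) s2 (scal_eps
    E)) //.
  by rewrite /c2 mulrBl ceps_idem mulrC [_ * ceps _ _]mulrC eE // subrr mulr0.
have [||z] := indec _ _ Zx Z2 o.
- by move=> N sN; rewrite addrC subrK.
- by move=> z; case: (eps_neq0 sW pW E).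
by move=> N sN; have := z N sN; rewrite bmkD bmkN bmk0 => /eqP; rewrite subr_eq0 => /eqP.
Qed.

End Idempotents.

Theorem theorem3p8 (gT : finGroupType) (G : {group gT}) (R : idomainType)
    (Sig Th : {set {group gT}}) :
  (* |G| is invertible in K = Frac(R) *)
  ((#|G|%:R : {fraction R}) \is a GRing.unit) ->
  (* {0} <> pR <> R for all primes p dividing |Out(U)|, U <= G *)
  (forall U : {group gT}, U \subset G -> forall p : nat, prime p ->
     (p %| #|Out U|)%N -> (p%:R : R) != 0 /\ ~~ ((p%:R : R) \is a GRing.unit)) ->
  conj_reps G Sig ->
  iso_reps G (piG G R) Sig Th ->
  (* the elements hat-eps_W exist in K B(G) *)
  (forall W : {group gT}, W \in Th ->
     exists x : {ffun {group gT} -> {fraction R}}, is_eps_hat G (piG G R) Sig W x) /\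
  (* for any representatives x W of hat-eps_W, the Delta(x W) are as claimed *)
  (forall x : {group gT} -> {ffun {group gT} -> {fraction R}},
     (forall W, W \in Th -> is_eps_hat G (piG G R) Sig W (x W)) ->
     [/\ forall W, W \in Th -> prim_central_idem G (Dlt G (x W)),
         forall W W', W \in Th -> W' \in Th -> W != W' ->
           borth G (Dlt G (x W)) (Dlt G (x W')),
         beq G (\sum_(W in Th) Dlt G (x W)) (bone G _) &
         (* hence every primitive central idempotent is one of them *)
         forall e, prim_central_idem G e ->
           exists2 W, W \in Th & beq G e (Dlt G (x W))]).
Proof.
move=> uG hOut repS [sTh repT uniqT].
have nzGR : #|G|%:R != 0 :> R.
  by move: uG; rewrite unitfE -(rmorph_nat (@tofrac R)) tofrac_eq0.
have ThP (W : {group gT}) : W \in Th -> W \subset G /\ pi_perfect (piG G R) W.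
  by move=> /(subsetP sTh); rewrite inE => /andP[SW pW]; case: repS => /(_ _ SW).
have findW (U : {group gT}) : U \subset G -> exists2 W, W \in Th & (piRes (piG G R) U \isog W)%g.
  move=> sU; apply: (repT (piRes_group (piG G R) U)).
    exact: subset_trans (piRes_sub _ U) sU.
  by apply/pi_perfectP; apply: piRes_id.
split=> [W ThW|x Hx].
  have [r Er] := eps_integral nzGR W; exists (fr r) => H sH.
  by rewrite eps_sum // gmk_fr Er // rmorph_nat.
have E W : W \in Th -> forall H : {group gT}, H \subset G -> gmk G (x W) H = ceps G R W H.
  by move=> ThW H sH; rewrite Hx // eps_sum.
split.
- by move=> W ThW; have [sW pW] := ThP W ThW; apply: (eps_prim nzGR hOut sW pW (E W ThW)).
- move=> W W' ThW ThW' ne; apply: (eps_orth nzGR _ (E W ThW) (E W' ThW')).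
  by apply: contra ne => iso; apply/eqP; apply: uniqT.
- move=> N sN; have sU := snd_sub sN.
  have -> : bmk G (\sum_(W in Th) Dlt G (x W)) N = \sum_(W in Th) bmk G (Dlt G (x W)) N.
    elim/big_rec2: _ => [|W a b _ <-]; [exact: bmk0 | exact: bmkD].
  rewrite (eq_bigr (fun W => ceps G R W (snd @* N)%G * (ucount G N)%:R)); last first.
    by move=> W ThW; rewrite (scal_eps (E W ThW)).
  rewrite -mulr_suml scal_bone //; congr (_ * _).
  (* Exactly one W in [Th] is isomorphic to the residue of the source of N, so the scalars of the
     sum add up to 1. *)
  have [W ThW iso] := findW _ sU; rewrite (bigD1 W) //= /ceps iso big1 ?addr0 // => W' /andP[ThW' ne].
  case: (boolP (_ \isog W')%g) => // iso'; case/eqP: ne; apply: uniqT => //.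
  by apply: isog_trans iso; rewrite (@isog_sym _ _ W' (piRes_group _ (snd @* N)%G)).
move=> e Pe; have [Ze nze _] := Pe.
(* A nonzero e has a nonzero scalar at some U, and the residue of U selects W. *)
have [/existsP[U /andP[sU nzU]]|] := boolP [exists U : {group gT}, (U \subset G) && (cval G e U != 0)].
  have [W ThW iso] := findW U sU; exists W => //; have [sW pW] := ThP W ThW.
  exact: (prim_eps nzGR hOut Pe sU nzU sW pW iso (E W ThW)).
rewrite negb_exists => /forallP z; case: nze; apply/(bzeroP nzGR hOut Ze) => U sU.
by have := z U; rewrite sU negbK => /eqP.
Qed.
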